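(* Let $1\leq p<\infty$. Let $\{T_t\}_{t\geq0}$ be a uniformly continuous semigroup of composition operators in $\mathcal{H}^p$. Then $T_t=\mathrm{Id}$ for every $t\geq0$.
   Context: For $\theta\in\mathbb{R}$, $\mathbb{C}_\theta=\{s\in\mathbb{C}:\operatorname{Re}(s)>\theta\}$. Hardy spaces: let $\{p_j\}$ be the increasing sequence of primes; for $n=p_1^{\kappa_1}\cdots p_d^{\kappa_d}$ put $\kappa(n)=(\kappa_1,\kappa_2,\dots)$. The Bohr lift of a Dirichlet series $\varphi(s)=\sum a_nn^{-s}$ is $\mathcal{B}\varphi(z)=\sum a_nz^{\kappa(n)}$. For $1\le p<\infty$, $\mathcal{H}^p$ is the space of Dirichlet series $\varphi$ with $\mathcal{B}\varphi\in H^p(\mathbb{D}^\infty)$, where $H^p(\mathbb{D}^\infty)$ is identified with the closed subspace of $L^p(\mathbb{T}^\infty,m_\infty)$ of functions whose Fourier coefficients vanish off the finitely supported multi-indices with nonnegative entries ($m_\infty$ is Haar measure), and $\|\varphi\|_{\mathcal{H}^p}=\left(\int_{\mathbb{T}^\infty}|\mathcal{B}\varphi|^p\,dm_\infty\right)^{1/p}$. It is a Banach space of analytic functions on $\mathbb{C}_{1/2}$. A composition operator in $\mathcal{H}^p$ is a bounded operator $\mathcal{H}^p\to\mathcal{H}^p$ of the form $f\mapsto f\circ\Phi$ with $\Phi:\mathbb{C}_{1/2}\to\mathbb{C}_{1/2}$ analytic. A family $\{T_t\}_{t\ge0}$ of bounded operators on a Banach space $X$ is a semigroup if $T_0=\mathrm{Id}$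 and $T_t\circ T_u=T_{t+u}$ for all $t,u\ge0$; it is uniformly continuous if, in addition, $\|T_t-\mathrm{Id}\|\to0$ in operator norm as $t\to0^+$. *)

(* Defs.v *)
From HB Require Import structures.
From mathcomp Require Import all_boot all_order all_algebra.
From mathcomp Require Import finmap complex.
From mathcomp Require Import all_classical all_reals all_analysis.

Set Implicit Arguments.
Unset Strict Implicit.
Unset Printing Implicit Defensive.

Import Order.TTheory GRing.Theory Num.Theory.
Import numFieldNormedType.Exports.

Local Open Scope classical_set_scope.
Local Open Scope ring_scope.
Local Open Scope complex_scope.

(* The complex numbers, as a normed space over themselves: [R[i]^o] is the
   copy of [R[i]] that carries the topology, so that [derivable f s 1] on it
   is complex differentiability at [s]. *)
Notation Cplx R := (R[i]^o).

Definition cmod (R : realType) (z : Cplx R) : R := ComplexField.Normc.normc z.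

Section Operators.
Context (R : realType) (V : lmodType R[i]) (X : set V) (nrm : V -> R).

(* [X] with [nrm] is a normed subspace of [V]; operators are functions on [V]
   whose values off [X] are irrelevant. *)
Definition bounded_operator (T : V -> V) : Prop :=
  [/\ forall f, X f -> X (T f),
      forall (c : R[i]) f g, X f -> X g -> T (c *: f + g) = c *: T f + T g
    & exists M : R, forall f, X f -> nrm (T f) <= M * nrm f].

Definition op_norm (T : V -> V) : \bar R :=
  ereal_sup [set (nrm (T f))%:E | f in [set f | X f /\ nrm f <= 1]].

Definition semigroup (T : R -> V -> V) : Prop :=
  [/\ forall t : R, 0 <= t -> bounded_operator (T t),
      forall f, X f -> T 0 f = f
    & forall t u : R, 0 <= t -> 0 <= u ->
        forall f, X f -> T (t + u) f = T t (T u f)].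

Definition uniformly_continuous_semigroup (T : R -> V -> V) : Prop :=
  semigroup T /\ op_norm (fun f => T t f - f) @[t --> 0^'+] --> 0%E.

End Operators.

Definition circle (R : realType) := {z : Cplx R | cmod z == 1}.

Section Circle.
Context (R : realType).

Lemma circle_one_subproof : cmod (1 : Cplx R) == 1.
Proof. by rewrite /cmod /= expr1n expr0n addr0 sqrtr1. Qed.

Lemma circle_mul_subproof (w z : circle R) : cmod (val w * val z) == 1.
Proof.
have /eqP := valP w; have /eqP := valP z; rewrite /cmod => z1 w1.
by rewrite ComplexField.Normc.normcM z1 w1 mulr1.
Qed.

HB.instance Definition _ := Choice.on (circle R).
HB.instance Definition _ := isPointed.Build (circle R)
  (exist _ 1 circle_one_subproof).

Definition circle_mul (w z : circle R) : circle R :=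
  exist _ (val w * val z) (circle_mul_subproof w z).

End Circle.

(* Generators of the product (equivalently, Borel) sigma-algebra. *)
Definition torus_cylinders (R : realType) : set (set (nat -> circle R)) :=
  [set A | exists (j : nat) (U : set (Cplx R)),
     open U /\ A = [set z | U (val (z j))]].

Definition torus (R : realType) := g_sigma_algebraType (@torus_cylinders R).

HB.instance Definition _ (R : realType) :=
  Measurable.copy (torus R) (g_sigma_algebraType (@torus_cylinders R)).

Definition rotation (R : realType) (w z : torus R) : torus R :=
  fun j => circle_mul (w j) (z j).

(* Haar measure is normalised here by the type [probability]. *)
Definition is_haar (R : realType) (m : probability (torus R) R) : Prop :=
  forall (w : torus R) (A : set (torus R)),
    measurable A -> m (rotation w @^-1` A) = m A.

Definition next_prime (m : nat) : nat :=
  ex_minn (let: exist2 q lt_mq pr_q := prime_above m in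
           ex_intro (fun q => (m < q)%N && prime q) q
             (introT andP (conj lt_mq pr_q))).

Definition nth_prime (j : nat) : nat := iter j next_prime 2.

(* Positions [j >= n] may be dropped, since the j-th prime then exceeds [n];
   see [kappaE]. *)
Definition kappa (n : nat) : {fsfun nat -> int with 0} :=
  [fsfun j in [fset j in iota 0 n]%fset => (logn (nth_prime j) n)%:Z].

Lemma nth_prime_gt (j : nat) : (j < nth_prime j)%N.
Proof.
elim: j => // j IHj; rewrite /nth_prime iterS -/(nth_prime j) /next_prime.
by case: ex_minnP => q /andP[lt_q _] _; exact: leq_ltn_trans lt_q.
Qed.

Lemma kappaE (n j : nat) : (0 < n)%N -> kappa n j = logn (nth_prime j) n.
Proof.
move=> n_gt0; rewrite /kappa fsfunE !inE mem_iota /= add0n.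
case: ltnP => // le_nj; congr Posz; apply/esym/eqP.
rewrite -leqn0 leqNgt logn_gt0 mem_primes n_gt0 /=.
apply/negP => /andP[_ /(dvdn_leq n_gt0)].
by rewrite leqNgt (leq_ltn_trans le_nj (nth_prime_gt j)).
Qed.

Section Hardy.
Context (R : realType) (m : probability (torus R) R).

Definition character (k : {fsfun nat -> int with 0}) (z : torus R) : R[i] :=
  \prod_(j <- finsupp k) val (z j) ^ k j.

Definition cintegral (F : torus R -> Cplx R) : Cplx R :=
  (\int[m]_z complex.Re (F z))%R +i* (\int[m]_z complex.Im (F z))%R.

Definition fourier (F : torus R -> Cplx R) (k : {fsfun nat -> int with 0}) :
    Cplx R :=
  cintegral (fun z => F z * (character k z)^*).

Definition Lp_norm (p : R) (F : torus R -> Cplx R) : \bar R :=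
  'N[m]_p%:E[EFin \o (@cmod R \o F)]%E.

Definition in_Lp (p : R) (F : torus R -> Cplx R) : Prop :=
  [/\ measurable_fun setT (fun z => complex.Re (F z)),
      measurable_fun setT (fun z => complex.Im (F z))
    & (Lp_norm p F < +oo)%E].

Definition in_hardy_torus (p : R) (F : torus R -> Cplx R) : Prop :=
  in_Lp p F /\
  forall k : {fsfun nat -> int with 0},
    (exists j, k j < 0) -> fourier F k = 0.

(* The formal Dirichlet series with coefficients [a]; entry [n] of [a] is the
   coefficient of (n+1)^(-s). *)
Definition dseries := nat -> Cplx R.

Definition bohr_lift (p : R) (a : dseries) : set (torus R -> Cplx R) :=
  [set F | in_hardy_torus p F /\ forall n, fourier F (kappa n.+1) = a n].

Definition hardy (p : R) : set dseries := [set a | bohr_lift p a !=set0].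

(* All elements of [bohr_lift p a] agree almost everywhere, because an
   integrable function on the torus is determined by its Fourier coefficients;
   the infimum is over the single value given by the Bohr lift of [a]. *)
Definition hardy_norm (p : R) (a : dseries) : R :=
  fine (ereal_inf [set Lp_norm p F | F in bohr_lift p a]).

(* n^(-s) = exp (- s ln n), with s split into real and imaginary parts. *)
Definition dirichlet_monomial (n : nat) (s : Cplx R) : Cplx R :=
  let r := expR (- (complex.Re s * ln n%:R)) in
  let x := complex.Im s * ln n%:R in
  (r * cos x) -i* (r * sin x).

Definition dirichlet_sum (a : dseries) (s : Cplx R) : Cplx R :=
  limn (series (fun n => a n * dirichlet_monomial n.+1 s)).

Definition half_plane (theta : R) : set (Cplx R) :=
  [set s | theta < complex.Re s].

(* Used for open [U], where complex differentiability is analyticity. *)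
Definition analytic_on (U : set (Cplx R)) (Phi : Cplx R -> Cplx R) : Prop :=
  forall s, U s -> derivable Phi s 1.

Definition composition_operator (p : R) (T : dseries -> dseries) : Prop :=
  bounded_operator (hardy p) (hardy_norm p) T /\
  exists Phi : Cplx R -> Cplx R,
    [/\ forall s, half_plane 2^-1 s -> half_plane 2^-1 (Phi s),
        analytic_on (half_plane 2^-1) Phi
      & forall f, hardy p f -> forall s, half_plane 2^-1 s ->
          dirichlet_sum (T f) s = dirichlet_sum f (Phi s)].

End Hardy.

(* Main.v *)
(* Write T for the operator T_t, Phi for its symbol and A_n for the series
   T(n^{-s}), whose sum is n^{-Phi(s)}. Coefficients are bounded by twice the
   norm, so for small t every coefficient of A_n differs from that of n^{-s} by
   at most eps, uniformly in n. Since coefficients are bounded, all series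
   converge absolutely for Re s >= 2, and they are determined by their values
   at integers.

   First, A_2 has no constant term: otherwise a_1 + a_2 2^{-s} vanishes on an
   arithmetic progression s_0 + 2 pi i Z / ln 2, where |A_3| <= |A_2| is of
   order eps 3^{-Re s}, which is impossible at two consecutive points.
   Secondly, if A_n has no term before n^{-s}, then A_n = n^{-s}: the powers
   A_n^j = A_{n^j} also have coefficients eps-close to those of n^{-js}, whereas
   any further term of A_n would contribute a coefficient to A_n^j growing
   linearly in j. Hence A_2 = 2^{-s}, so Re Phi(s) = Re s and
   |A_n(s)| = n^{-Re s}, which excludes terms of A_n before n^{-s}. Therefore
   n^{-Phi(s)} = n^{-s} for all n, so T f and f have the same sums and T = Id
   for small t, hence for all t by the semigroup law. *)

Require Import Defs.
From HB Require Import structures.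
From mathcomp Require Import all_boot all_order all_algebra.
From mathcomp Require Import finmap complex.
From mathcomp Require Import all_classical all_reals all_analysis.
From mathcomp Require Import measurable_realfun ring lra.

Set Implicit Arguments.
Unset Strict Implicit.
Unset Printing Implicit Defensive.

Import Order.TTheory GRing.Theory Num.Theory.
Import numFieldNormedType.Exports.

Local Open Scope classical_set_scope.
Local Open Scope ring_scope.

(** * Dirichlet series with bounded coefficients *)

Section ComplexModulus.
Context (R : realType).
Implicit Types z w : Cplx R.

Lemma cmodE z : cmod z = Num.sqrt (complex.Re z ^+ 2 + complex.Im z ^+ 2).
Proof. by case: z. Qed.

Lemma norm_cmod z : `|z| = (cmod z)%:C%C.
Proof. by rewrite cmodE -normc_def. Qed.

Lemma cmod_ge0 z : 0 <= cmod z.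
Proof. by rewrite cmodE sqrtr_ge0. Qed.

Lemma cmodM z w : cmod (z * w) = cmod z * cmod w.
Proof. exact: ComplexField.Normc.normcM. Qed.

Lemma cmod0 : cmod (0 : Cplx R) = 0.
Proof. exact: ComplexField.Normc.normc0. Qed.

Lemma cmod1 : cmod (1 : Cplx R) = 1.
Proof. exact: ComplexField.Normc.normc1. Qed.

Lemma cmodX z n : cmod (z ^+ n) = cmod z ^+ n.
Proof. by elim: n => [|n IH]; rewrite ?expr0 ?cmod1 // !exprS cmodM IH. Qed.

Lemma cmodN z : cmod (- z) = cmod z.
Proof. exact: (normcN z). Qed.

Lemma cmodV z : cmod z^-1 = (cmod z)^-1.
Proof. exact: ComplexField.Normc.normcV. Qed.

Lemma cmodD z w : cmod (z + w) <= cmod z + cmod w.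
Proof. exact: (le_normcD z w). Qed.

Lemma cmodB z w : cmod (z - w) <= cmod z + cmod w.
Proof. by rewrite -(cmodN w) cmodD. Qed.

Lemma cmodBC z w : cmod (z - w) = cmod (w - z).
Proof. by rewrite -opprB cmodN. Qed.

Lemma cmod_eq0 z : (cmod z == 0) = (z == 0).
Proof.
by apply/eqP/eqP => [/ComplexField.Normc.eq0_normc //|->]; rewrite cmod0.
Qed.

Lemma cmod_real (r : R) : cmod (r%:C%C : Cplx R) = `|r|.
Proof. by rewrite cmodE /= expr0n addr0 sqrtr_sqr. Qed.

Lemma natr_complex n : (n%:R : Cplx R) = (n%:R : R)%:C%C.
Proof. by rewrite rmorph_nat. Qed.

Lemma cmod_nat n : cmod (n%:R : Cplx R) = n%:R.
Proof. by rewrite natr_complex cmod_real ger0_norm. Qed.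

Lemma abs_Re_le z : `|complex.Re z| <= cmod z.
Proof. by rewrite cmodE -sqrtr_sqr ler_wsqrtr// lerDl sqr_ge0. Qed.

Lemma abs_Im_le z : `|complex.Im z| <= cmod z.
Proof. by rewrite cmodE -sqrtr_sqr ler_wsqrtr// lerDr sqr_ge0. Qed.

Lemma cmod_le_ReIm z : cmod z <= `|complex.Re z| + `|complex.Im z|.
Proof.
rewrite -(ger0_norm (addr_ge0 (normr_ge0 _) (normr_ge0 _))).
rewrite cmodE -sqrtr_sqr ler_wsqrtr// sqrrD !real_normK ?num_real//.
by rewrite addrAC lerDl mulrn_wge0 // mulr_ge0.
Qed.

Lemma gt0_complex (e : R[i]) : 0 < e -> e = (complex.Re e)%:C%C.
Proof. by case: e => x y; rewrite ltcE /= => /andP[/eqP ->]. Qed.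

(** The norm of [Cplx R] takes values in [R[i]], so a tolerance for the left-hand limit is a complex
    number; being positive it is real, which transfers the limit to [R]. *)
Lemma cvg_cmodP (u : nat -> Cplx R) (l : Cplx R) :
  u @ \oo --> l <-> (fun n => cmod (u n - l)) @ \oo --> (0 : R).
Proof.
split => /cvgrPdist_lt ul; apply/cvgrPdist_lt => e e0.
  have := ul e%:C%C; rewrite ltcR => /(_ e0); apply: filterS => n /=.
  rewrite sub0r normrN (ger0_norm (cmod_ge0 _)) cmodBC.
  by rewrite (_ : `|l - u n| = (cmod (l - u n))%:C%C) ?ltcR //; exact: norm_cmod.
have eE : e = (complex.Re e)%:C%C.
  exact: gt0_complex.
have {}e0 : 0 < complex.Re e by move: e0; rewrite eE ltcR.
have := ul _ e0; apply: filterS => n /=.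
rewrite sub0r normrN (ger0_norm (cmod_ge0 _)) cmodBC eE.
by rewrite (_ : `|l - u n| = (cmod (l - u n))%:C%C) ?ltcR //; exact: norm_cmod.
Qed.

Lemma cvg_cmod_le (u : nat -> Cplx R) (l : Cplx R) (v : nat -> R) :
  (\forall n \near \oo, cmod (u n - l) <= v n) ->
  v @ \oo --> (0 : R) -> u @ \oo --> l.
Proof.
move=> uv v0; apply/cvg_cmodP; apply: (@squeeze_cvgr _ _ _ _ (cst 0) v) => //.
  by near=> n; rewrite cmod_ge0 /=; near: n.
exact: cvg_cst.
Unshelve. all: by end_near. Qed.

Lemma cmod_lim_le (u : nat -> Cplx R) (l : Cplx R) (B : R) :
  (\forall n \near \oo, cmod (u n) <= B) -> u @ \oo --> l -> cmod l <= B.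
Proof.
move=> uB /cvg_cmodP/cvgrPdist_lt ul; apply/ler_addgt0Pr => e e0.
have [n [/= h1 h2]] : exists n, cmod (u n) <= B /\ cmod (u n - l) < e.
  near \oo => n; exists n; split; first by near: n.
  near: n; have := ul _ e0; apply: filterS => n /=.
  by rewrite sub0r normrN ger0_norm ?cmod_ge0.
have -> : l = u n - (u n - l) by rewrite opprB addrC subrK.
by apply: le_trans (cmodB _ _) _; apply: lerD => //; exact: ltW.
Unshelve. all: by end_near. Qed.

Lemma cvg_ReIm (u : nat -> Cplx R) (x y : R) :
  (fun n => complex.Re (u n)) @ \oo --> x ->
  (fun n => complex.Im (u n)) @ \oo --> y ->
  u @ \oo --> ((x +i* y)%C : Cplx R).
Proof.
move=> ux uy; apply: (@cvg_cmod_le _ _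
  (fun n => `|complex.Re (u n) - x| + `|complex.Im (u n) - y|)).
  apply: nearW => n; apply: (le_trans (cmod_le_ReIm _)).
  by case: (u n) => a b /=.
rewrite -[0]addr0; apply: cvgD; rewrite -(@normr0 _ R); apply: cvg_norm;
  [rewrite -(subrr x)|rewrite -(subrr y)]; apply: cvgB => //; exact: cvg_cst.
Qed.

Lemma cvgC_unique (u : nat -> Cplx R) (l l' : Cplx R) :
  u @ \oo --> l -> u @ \oo --> l' -> l = l'.
Proof. by apply: cvg_unique; exact: norm_hausdorff. Qed.

Lemma cvg_eventually_eq (u : nat -> Cplx R) (l : Cplx R) :
  (\forall n \near \oo, u n = l) -> u @ \oo --> l.
Proof.
move=> ul; apply: (@cvg_cmod_le _ _ (cst 0)); last exact: cvg_cst.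
by apply: filterS ul => n ->; rewrite subrr cmod0.
Qed.

End ComplexModulus.

(** * Absolute convergence and size of Dirichlet series on Re s >= 2 *)

Section DirichletSeries.
Context (R : realType).
Implicit Types (a c d : dseries R) (s : Cplx R) (sigma K : R).

(** The exponent is negated: this is n^{-sigma}, the modulus of n^{-s} on the line Re s = sigma. *)
Definition natpow (n : nat) sigma : R := expR (- (sigma * ln n%:R)).

Lemma natpow_gt0 n sigma : 0 < natpow n sigma.
Proof. exact: expR_gt0. Qed.

Lemma natpowM n k sigma : (0 < n)%N -> (0 < k)%N ->
  natpow (n * k) sigma = natpow n sigma * natpow k sigma.
Proof.
move=> n0 k0; rewrite /natpow natrM lnM ?posrE ?ltr0n// mulrDr opprD.
by rewrite expRD.
Qed.

Lemma natpowD n x y : natpow n (x + y) = natpow n x * natpow n y.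
Proof. by rewrite /natpow mulrDl opprD expRD. Qed.

Lemma natpow_nat n N : (0 < n)%N -> natpow n N%:R = (n%:R^-1) ^+ N.
Proof.
move=> n0; rewrite /natpow -mulrN mulrC expRM_natr expRN lnK ?posrE ?ltr0n//.
Qed.

Lemma natpow_le n k sigma : (0 < n)%N -> (n <= k)%N -> 0 <= sigma ->
  natpow k sigma <= natpow n sigma.
Proof.
move=> n0 nk s0; rewrite ler_expR lerN2 ler_wpM2l// ler_ln ?posrE ?ltr0n//.
  by rewrite ler_nat.
exact: leq_trans nk.
Qed.

(** Split n^{-sigma} as n^{-(sigma-2)} n^{-2} and replace n by k in the first factor. The whole tail
    from k on is thereby compared with k^{-sigma} times a sum of inverse squares. *)
Lemma natpow_tail n k sigma : (0 < k)%N -> (k <= n)%N -> 2 <= sigma ->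
  natpow n sigma <= natpow k sigma * k%:R ^+ 2 * (n%:R ^+ 2)^-1.
Proof.
move=> k0 kn s2; have n0 := leq_trans k0 kn.
have k2 : (k%:R ^+ 2 : R) != 0 by rewrite expf_neq0// pnatr_eq0 -lt0n.
rewrite -(subrK 2 sigma) !(natpowD _ (sigma - 2)) !natpow_nat// !exprVn.
rewrite divfK//.
rewrite ler_wpM2r ?invr_ge0 ?exprn_ge0// natpow_le// subr_ge0//.
Qed.

Lemma monomial_polar n s : dirichlet_monomial n s =
  (natpow n (complex.Re s))%:C%C *
  (cos (complex.Im s * ln n%:R) -i* sin (complex.Im s * ln n%:R))%C.
Proof.
rewrite /dirichlet_monomial -/(natpow n _); apply/eqP.
by rewrite eq_complex /=; apply/andP; split; apply/eqP; ring.
Qed.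

Lemma cmod_polar (x : R) : cmod (cos x -i* sin x : Cplx R)%C = 1.
Proof. by rewrite cmodE /= sqrrN cos2Dsin2 sqrtr1. Qed.

Lemma cmod_monomial n s :
  cmod (dirichlet_monomial n s) = natpow n (complex.Re s).
Proof.
by rewrite monomial_polar cmodM cmod_polar mulr1 cmod_real gtr0_norm ?natpow_gt0.
Qed.

Lemma monomialM n k s : (0 < n)%N -> (0 < k)%N ->
  dirichlet_monomial (n * k) s = dirichlet_monomial n s * dirichlet_monomial k s.
Proof.
move=> n0 k0; rewrite !monomial_polar natpowM// natrM lnM ?posrE ?ltr0n//.
rewrite mulrDr cosD sinD; apply/eqP.
by rewrite eq_complex /=; apply/andP; split; apply/eqP; ring.
Qed.

Lemma monomial1 s : dirichlet_monomial 1 s = 1.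
Proof.
apply/eqP; rewrite /dirichlet_monomial ln1 !mulr0 oppr0 expR0 cos0 sin0.
by rewrite mulr1 mulr0 eq_complex /= oppr0 !eqxx.
Qed.

Lemma monomialX n j s : (0 < n)%N ->
  dirichlet_monomial (n ^ j) s = dirichlet_monomial n s ^+ j.
Proof.
move=> n0; elim: j => [|j IH]; first by rewrite expn0 monomial1 expr0.
by rewrite expnS exprS monomialM ?expn_gt0 ?n0// IH.
Qed.

Lemma ReIm_nat N : complex.Re (N%:R : Cplx R) = N%:R /\
  complex.Im (N%:R : Cplx R) = 0.
Proof. by rewrite natr_complex. Qed.

Lemma monomial_nat n N : (0 < n)%N ->
  dirichlet_monomial n (N%:R : Cplx R) = (n%:R : Cplx R)^-1 ^+ N.
Proof.
move=> n0; have [reN imN] := ReIm_nat N.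
rewrite monomial_polar reN imN mul0r cos0 sin0 natpow_nat//.
rewrite rmorphXn /= fmorphV rmorph_nat -[RHS]mulr1; congr (_ * _).
by apply/eqP; rewrite eq_complex /= oppr0 !eqxx.
Qed.

Lemma sum_invsq_le n : \sum_(i < n) ((i.+1%:R : R) ^+ 2)^-1 <= 2.
Proof.
(* The sharper bound 2 - 1/(n+1) for n+1 terms is the one that passes through the induction. *)
suff : \sum_(i < n.+1) ((i.+1%:R : R) ^+ 2)^-1 <= 2 - n.+1%:R^-1.
  rewrite big_ord_recr /= => h; apply: le_trans (le_trans h _).
    by rewrite lerDl invr_ge0 exprn_ge0.
  by rewrite gerBl invr_ge0.
elim: n => [|n IH]; first by rewrite big_ord_recr big_ord0 /=; lra.
rewrite big_ord_recr /=; apply: le_trans (lerD IH (lexx _)) _.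
have : 0 < (n.+1%:R : R) by rewrite ltr0n.
rewrite -(natr1 n.+1); move: (n.+1%:R : R) => x x0.
have x1 : 0 < x + 1 by rewrite addr_gt0.
rewrite -subr_ge0.
have -> : 2 - (x + 1)^-1 - (2 - x^-1 + ((x + 1) ^+ 2)^-1) =
  (x * (x + 1) ^+ 2)^-1 by field; rewrite !gt_eqF.
by rewrite invr_ge0 mulr_ge0 ?exprn_ge0// ltW.
Qed.

Definition bounded_by K a := forall n, cmod (a n) <= K.

Definition dterm a s : (Cplx R)^nat := fun n => a n * dirichlet_monomial n.+1 s.

Lemma cmod_dterm_le K a s n M : bounded_by K a -> 2 <= complex.Re s ->
  (M <= n)%N -> cmod (dterm a s n) <=
    K * (natpow M.+1 (complex.Re s) * M.+1%:R ^+ 2) * (n.+1%:R ^+ 2)^-1.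
Proof.
move=> aK s2 Mn; rewrite cmodM cmod_monomial -mulrA.
apply: ler_pM => //; [exact: cmod_ge0|exact/ltW/natpow_gt0|].
exact: natpow_tail.
Qed.

(** Terms before index [M] vanish; [natpow_tail] with k = M+1 bounds the others by multiples of
    inverse squares, whose partial sums stay below 2. *)
Lemma partial_dsum_le K a s n M : bounded_by K a -> 2 <= complex.Re s ->
  (forall i, (i < M)%N -> a i = 0) ->
  \sum_(i < n) cmod (dterm a s i) <=
    2 * K * M.+1%:R ^+ 2 * natpow M.+1 (complex.Re s).
Proof.
move=> aK s2 a0; have K0 : 0 <= K by exact: le_trans (cmod_ge0 _) (aK 0%N).
set B := K * (natpow M.+1 (complex.Re s) * M.+1%:R ^+ 2).
have B0 : 0 <= B by rewrite !mulr_ge0// ?exprn_ge0// ltW// natpow_gt0.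
apply: (@le_trans _ _ (\sum_(i < n) B * (i.+1%:R ^+ 2)^-1)).
  apply: ler_sum => i _; have [iM|Mi] := ltnP i M.
    by rewrite /dterm a0// mul0r cmod0 mulr_ge0// invr_ge0 exprn_ge0.
  exact: cmod_dterm_le.
rewrite -mulr_sumr; apply: le_trans (ler_wpM2l B0 (sum_invsq_le n)) _.
by rewrite /B le_eqVlt; apply/orP; left; apply/eqP; ring.
Qed.

(** Real and imaginary parts are dominated by the moduli, so each gives an absolutely convergent
    real series. *)
Lemma cvgn_cmod_series (u : (Cplx R)^nat) (B : R) :
  (forall n, \sum_(i < n) cmod (u i) <= B) -> cvgn (series u).
Proof.
move=> uB.
have bnd (v : R^nat) : (forall n, `|v n| <= cmod (u n)) -> cvgn (series v).
  move=> vu; apply: (@normed_cvg R R).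
  suff : cvgn (series (fun n => `|v n| : R)) by [].
  apply: nondecreasing_is_cvgn.
    by apply/nondecreasing_seqP => n; rewrite seriesSr lerDl normr_ge0.
  exists B => _ [n _ <-]; rewrite seriesEord /=.
  by apply: le_trans (uB n); apply: ler_sum.
have /cvg_ex[x xP] := bnd (fun n => complex.Re (u n)) (fun n => abs_Re_le (u n)).
have /cvg_ex[y yP] := bnd (fun n => complex.Im (u n)) (fun n => abs_Im_le (u n)).
apply/cvg_ex; exists (x +i* y)%C; apply: cvg_ReIm.
  apply: cvg_trans xP; apply: near_eq_cvg; apply: nearW => n.
  rewrite /series /=; elim/big_ind2 : _ => // z1 w1 z2 w2 -> ->.
  by case: z1 => ? ?; case: z2.
apply: cvg_trans yP; apply: near_eq_cvg; apply: nearW => n.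
rewrite /series /=; elim/big_ind2 : _ => // z1 w1 z2 w2 -> ->.
by case: z1 => ? ?; case: z2.
Qed.

Lemma dirichlet_sum_cvg K a s : bounded_by K a -> 2 <= complex.Re s ->
  series (dterm a s) @ \oo --> dirichlet_sum a s.
Proof.
move=> aK s2; apply: (@cvgn_cmod_series (dterm a s)).
move=> n; exact: (@partial_dsum_le K _ _ _ 0%N).
Qed.

Lemma dirichlet_sum_lim a s (l : Cplx R) :
  series (dterm a s) @ \oo --> l -> dirichlet_sum a s = l.
Proof. by apply: cvg_lim; exact: norm_hausdorff. Qed.

Lemma dirichlet_sum_le K a s M : bounded_by K a -> 2 <= complex.Re s ->
  (forall i, (i < M)%N -> a i = 0) ->
  cmod (dirichlet_sum a s) <= 2 * K * M.+1%:R ^+ 2 * natpow M.+1 (complex.Re s).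
Proof.
move=> aK s2 a0; apply: cmod_lim_le (dirichlet_sum_cvg aK s2).
apply: nearW => n; apply: le_trans (partial_dsum_le n aK s2 a0).
rewrite /series /= big_mkord; elim/big_ind2 : _ => // [|z x w y zx wy].
  by rewrite cmod0.
by apply: le_trans (cmodD _ _) _; exact: lerD.
Qed.

Lemma bounded_byB K L a c : bounded_by K a -> bounded_by L c ->
  bounded_by (K + L) (a - c).
Proof. by move=> aK cL n; apply: le_trans (cmodB _ _) _; exact: lerD. Qed.

Lemma dirichlet_sumB K L a c s : bounded_by K a -> bounded_by L c ->
  2 <= complex.Re s ->
  dirichlet_sum (a - c) s = dirichlet_sum a s - dirichlet_sum c s.
Proof.
move=> aK cL s2; apply: dirichlet_sum_lim.
rewrite (_ : series _ = series (dterm a s) - series (dterm c s)).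
  by apply: cvgB; [exact: dirichlet_sum_cvg aK s2|exact: dirichlet_sum_cvg cL s2].
apply/funext => n; rewrite /series /= [RHS]/GRing.add /= [X in _ + X]/GRing.opp /=.
by rewrite -sumrB; apply: eq_bigr => i _; rewrite /dterm -mulrBl.
Qed.

(** The one-term Dirichlet series x (k+1)^{-s}: index [k] stands for the base k+1. *)
Definition point_mass (k : nat) (x : Cplx R) : dseries R :=
  fun n => if n == k then x else 0.

Lemma bounded_point_mass k x : bounded_by (cmod x) (point_mass k x).
Proof.
by move=> n; rewrite /point_mass; case: eqP => // _; rewrite cmod0 cmod_ge0.
Qed.

Lemma dirichlet_sum_point_mass k x s :
  dirichlet_sum (point_mass k x) s = x * dirichlet_monomial k.+1 s.
Proof.
apply: dirichlet_sum_lim; apply: cvg_eventually_eq; exists k.+1 => // n /= kn.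
rewrite /series /= big_mkord (bigD1 (Ordinal kn)) //= big1 ?addr0.
  by rewrite /dterm /point_mass eqxx.
move=> i; rewrite -val_eqE /= /dterm /point_mass => /negbTE ->.
by rewrite mul0r.
Qed.

End DirichletSeries.

(** * Recovering coefficients from values at integers, and rigidity of powers *)

Section Uniqueness.
Context (R : realType).
Implicit Types (a c d : dseries R) (K : R).

Lemma two_le_Re_nat N : (2 <= N)%N -> 2 <= complex.Re (N%:R : Cplx R).
Proof. by move=> N2; rewrite (ReIm_nat _ N).1 ler_nat. Qed.

Lemma cvg_ratio_pow (n k : nat) : (n < k)%N ->
  (fun N : nat => (n%:R / k%:R : R) ^+ N) @ \oo --> (0 : R).
Proof.
move=> nk; have k0 : 0 < (k%:R : R) by rewrite ltr0n (leq_trans _ nk).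
apply: cvg_expr; rewrite ger0_norm ?divr_ge0 ?(ltW k0)//.
by rewrite ltr_pdivrMr// mul1r ltr_nat.
Qed.

(** Without its term at [M], the series is of order (M+2)^{-N} at N, which remains negligible after
    multiplication by (M+1)^N. *)
Lemma cvg_leading_coef K d M : bounded_by K d ->
  (forall i, (i < M)%N -> d i = 0) ->
  (fun N => (M.+1%:R : Cplx R) ^+ N * dirichlet_sum d (N%:R : Cplx R)) @ \oo
    --> d M.
Proof.
move=> dK d0; pose r := d - point_mass M (d M).
have rK : bounded_by (K + cmod (d M)) r.
  by apply: bounded_byB => //; exact: bounded_point_mass.
have r0 i : (i < M.+1)%N -> r i = 0.
  rewrite ltnS leq_eqVlt /r /point_mass => /predU1P[->|iM].
    by rewrite [LHS]/GRing.add /= [X in _ + X]/GRing.opp /= eqxx subrr.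
  rewrite [LHS]/GRing.add /= [X in _ + X]/GRing.opp /= d0// sub0r.
  by rewrite ltn_eqF// oppr0.
pose C := 2 * (K + cmod (d M)) * M.+2%:R ^+ 2.
apply: (@cvg_cmod_le _ _ _ (fun N => C * (M.+1%:R / M.+2%:R) ^+ N)); last first.
  by rewrite -[X in _ --> X](mulr0 C); apply: cvgMr; exact: cvg_ratio_pow.
exists 2%N => // N /= N2.
have s2 := two_le_Re_nat N2.
have M1 : (M.+1%:R : Cplx R) ^+ N != 0 by rewrite expf_neq0// pnatr_eq0.
have -> : (M.+1%:R : Cplx R) ^+ N * dirichlet_sum d (N%:R : Cplx R) - d M =
    (M.+1%:R : Cplx R) ^+ N * dirichlet_sum r (N%:R : Cplx R).
  rewrite (dirichlet_sumB dK (@bounded_point_mass _ M (d M)) s2).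
  rewrite dirichlet_sum_point_mass monomial_nat// mulrBr exprVn.
  by rewrite [X in _ = _ - X]mulrCA mulfV// mulr1.
rewrite cmodM cmodX cmod_nat.
have := dirichlet_sum_le rK s2 r0.
rewrite (ReIm_nat _ N).1 natpow_nat// => h.
apply: le_trans (ler_wpM2l (exprn_ge0 N (ler0n _ _)) h) _.
by rewrite exprMn mulrCA.
Qed.

(** For i <= M the values at N multiplied by (i+1)^N tend to 0 as well. By strong induction on i all
    earlier coefficients vanish, so this limit is also [d i]. *)
Lemma coef_eq0 K d M : bounded_by K d ->
  (fun N => (M.+1%:R : Cplx R) ^+ N * dirichlet_sum d (N%:R : Cplx R)) @ \oo
    --> (0 : Cplx R) ->
  forall i, (i <= M)%N -> d i = 0.
Proof.
move=> dK dM; elim/ltn_ind => i IH iM.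
have di := @cvg_leading_coef K d i dK (fun j ji => IH j ji (ltnW (leq_trans ji iM))).
move: iM; rewrite leq_eqVlt => /predU1P[iM|iM].
  by rewrite iM in di *; exact: cvgC_unique di dM.
apply: cvgC_unique di _.
have M0 N : (M.+1%:R : Cplx R) ^+ N != 0 by rewrite expf_neq0// pnatr_eq0.
have -> : (fun N => (i.+1%:R : Cplx R) ^+ N * dirichlet_sum d (N%:R : Cplx R)) =
    (fun N => (i.+1%:R / M.+1%:R : Cplx R) ^+ N) \*
    (fun N => (M.+1%:R : Cplx R) ^+ N * dirichlet_sum d (N%:R : Cplx R)).
  by apply/funext => N /=; rewrite expr_div_n mulrA divfK.
rewrite -[X in _ --> X](mulr0 (0 : Cplx R)); apply: cvgM dM.
apply/cvg_cmodP; have /= := @cvg_ratio_pow i.+1 M.+1 iM.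
apply: cvg_trans; apply: near_eq_cvg; apply: nearW => N.
by rewrite subr0 cmodX cmodM cmodV !cmod_nat.
Qed.

Lemma dirichlet_sum_inj K L a c : bounded_by K a -> bounded_by L c ->
  (forall N, (2 <= N)%N ->
    dirichlet_sum a (N%:R : Cplx R) = dirichlet_sum c (N%:R : Cplx R)) ->
  a = c.
Proof.
move=> aK cL ac; apply/funext => i; apply/eqP; rewrite -subr_eq0; apply/eqP.
apply: (@coef_eq0 _ (a - c) i (bounded_byB aK cL)) => //.
apply: cvg_eventually_eq; exists 2%N => // N /= N2.
by rewrite (dirichlet_sumB aK cL) ?two_le_Re_nat// ac// subrr mulr0.
Qed.

(* If [|z^j - 1| <= 1/2] for all [j], then squaring multiplies the distance to
   1 by [|z^j + 1| >= 3/2], so that the distance must vanish. *)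
Lemma powers_near1 (z : Cplx R) :
  (forall j, cmod (z ^+ j - 1) <= 2^-1) -> z = 1.
Proof.
move=> zj; apply/eqP; rewrite -subr_eq0 -cmod_eq0; apply/eqP/le_anti.
rewrite cmod_ge0 andbT leNgt; apply/negP => d0.
(* Each squaring gains a factor 3/2; the linear minorant 1 + i/2 of (3/2)^i is enough to push the
   distance past 1/2. *)
have grow i : (1 + i%:R * 2^-1) * cmod (z - 1) <= cmod (z ^+ (2 ^ i) - 1).
  elim: i => [|i IH]; first by rewrite mul0r addr0 mul1r.
  rewrite expnSr exprM; set w := z ^+ (2 ^ i) in IH *.
  have -> : w ^+ 2 - 1 = (w - 1) * (w + 1) by ring.
  have w1 : 3 / 2 <= cmod (w + 1).
    have : cmod (2%:R : Cplx R) <= cmod (w + 1) + cmod (w - 1).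
      by rewrite (_ : 2%:R = (w + 1) - (w - 1)) ?cmodB//; ring.
    by rewrite cmod_nat; have := zj (2 ^ i)%N; rewrite -/w; lra.
  rewrite cmodM; apply: le_trans (ler_pM _ _ IH w1); last 2 first.
  - by rewrite mulr_ge0 ?cmod_ge0// addr_ge0// mulr_ge0.
  - by [].
  rewrite mulrAC ler_wpM2r ?cmod_ge0// -natr1.
  by have : 0 <= (i%:R : R) by []; lra.
have [i /= iP] : exists i : nat, (cmod (z - 1))^-1 <= i%:R.
  exists (Num.bound (cmod (z - 1))^-1); apply/ltW/archi_boundP.
  by rewrite invr_ge0 ltW.
have := le_trans (grow i) (zj _).
rewrite mulrDl mul1r mulrAC.
have : 1 <= i%:R * cmod (z - 1) by rewrite -ler_pdivrMr// mul1r.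
by lra.
Qed.

(** The derivative of a power in sequential form: the induction is the product rule, using v(ww' -
    zz') = v(w' - z')w + z'v(w - z). *)
Lemma cvg_pow_increment (q y : nat -> Cplx R) (a b : Cplx R) (i : nat) :
  y @ \oo --> b -> (fun N => q N * (y N - b)) @ \oo --> a ->
  (fun N => q N * (y N ^+ i.+1 - b ^+ i.+1)) @ \oo --> i.+1%:R * b ^+ i * a.
Proof.
move=> yb qa; elim: i => [|i IH]; first by rewrite expr0 !mul1r.
have stepE (v w w' z z' : Cplx R) :
  v * (w * w' - z * z') = v * (w' - z') * w + z' * (v * (w - z)) by ring.
have limE (x z z' w : Cplx R) :
  (x + 1) * (z * z') * w = x * z' * w * z + z * z' * w by ring.
have -> : (fun N => q N * (y N ^+ i.+2 - b ^+ i.+2)) =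
  (fun N => q N * (y N ^+ i.+1 - b ^+ i.+1)) \* y \+
  (cst (b ^+ i.+1) \* (fun N => q N * (y N - b))).
  by apply/funext => N /=; rewrite [y N ^+ i.+2]exprS [b ^+ i.+2]exprS stepE.
rewrite -(natr1 i.+1) exprS limE -exprS.
apply: cvgD; first exact: (cvgM IH yb).
by apply: (cvgM _ qa); exact: cvg_cst.
Qed.

(** Meant for A = (n+1)^N, B = (k+1)^N and x the value of a series at N. Scaling by the N-th power
    of (n+1)^j (k+1) turns x^{j+1}, less its two expected terms, into the increment of
    [cvg_pow_increment] less its limit. *)
Lemma scaled_difference (F : fieldType) (A B x w z : F) (j : nat) :
  A != 0 -> B != 0 ->
  A ^+ j * B * (x ^+ j.+1 - w * A^-1 ^+ j.+1 - z * (A^-1 ^+ j * B^-1)) =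
  B / A * ((A * x) ^+ j.+1 - w) - z.
Proof.
move=> A0 B0; rewrite exprMn !exprVn [A ^+ j.+1]exprS.
have : A ^+ j != 0 by rewrite expf_neq0.
by move: (A ^+ j) (x ^+ _) => P y P0; field; rewrite A0 B0 P0.
Qed.

(* If [D = D(c 1)] has leading terms [b (n+1)^{-s} + a (k+1)^{-s}], then the
   coefficient of [((n+1)^j (k+1))^{-s}] in [D^{j+1}] is [(j+1) b^j a]. Once
   [b = 1], its boundedness in [j] forces [a = 0]. *)
Lemma power_rigidity (n : nat) (c : nat -> dseries R) :
  (forall j i, cmod (c j i - (i.+1 == n.+1 ^ j)%N%:R) <= 2^-1) ->
  (forall j N, (2 <= N)%N -> dirichlet_sum (c j) (N%:R : Cplx R) =
    dirichlet_sum (c 1%N) (N%:R : Cplx R) ^+ j) ->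
  (forall i, (i < n)%N -> c 1%N i = 0) ->
  c 1%N = point_mass n 1.
Proof.
move=> cnear cpow c0.
have cK j : bounded_by (2^-1 + 1) (c j).
  move=> i; rewrite -[c j i](subrK (i.+1 == n.+1 ^ j)%N%:R).
  apply: le_trans (cmodD _ _) (lerD (cnear j i) _).
  by rewrite cmod_nat; case: eqP.
pose X N := dirichlet_sum (c 1%N) (N%:R : Cplx R).
pose b := c 1%N n.
pose Y N := (n.+1%:R : Cplx R) ^+ N * X N.
have Yb : Y @ \oo --> b by exact: cvg_leading_coef (cK 1%N) c0.
have n1 N : (n.+1%:R : Cplx R) ^+ N != 0 by rewrite expf_neq0// pnatr_eq0.
(* Subtract from [c j.+1] the two expected point masses. The remainder at N, multiplied by the N-th
   power of the larger base, tends to 0, so [coef_eq0] annihilates its coefficients up to [v], in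
   particular at [u] and [v]. *)
have Xpow (k : nat) (a : Cplx R) : (n < k)%N ->
    (fun N => (k.+1%:R / n.+1%:R : Cplx R) ^+ N * (Y N - b)) @ \oo --> a ->
  forall j, c j.+1 (n.+1 ^ j.+1).-1 = b ^+ j.+1 /\
            c j.+1 (n.+1 ^ j * k.+1).-1 = j.+1%:R * b ^+ j * a.
  move=> nk qa j; pose q N := (k.+1%:R / n.+1%:R : Cplx R) ^+ N.
  have qY i : (fun N => q N * (Y N ^+ i.+1 - b ^+ i.+1)) @ \oo
      --> i.+1%:R * b ^+ i * a.
    exact: (@cvg_pow_increment q Y a b i Yb qa).
  set u := (n.+1 ^ j.+1).-1; set v := (n.+1 ^ j * k.+1).-1.
  have uE : u.+1 = (n.+1 ^ j.+1)%N by rewrite prednK// expn_gt0.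
  have vE : v.+1 = (n.+1 ^ j * k.+1)%N by rewrite prednK// muln_gt0 expn_gt0.
  have uv : (u < v)%N by rewrite -ltnS uE vE expnSr ltn_pmul2l// expn_gt0.
  pose z := j.+1%:R * b ^+ j * a.
  pose d1 := c j.+1 - point_mass u (b ^+ j.+1).
  have d1K := bounded_byB (cK j.+1) (@bounded_point_mass R u (b ^+ j.+1)).
  pose d2 := d1 - point_mass v z.
  have d2K := bounded_byB d1K (@bounded_point_mass R v z).
  have d2E i : d2 i = c j.+1 i - point_mass u (b ^+ j.+1) i - point_mass v z i.
    by [].
  have d20 := @coef_eq0 _ d2 v d2K _.
  have {}d20 i : (i <= v)%N -> d2 i = 0.
    apply: d20; rewrite -(subrr z).
    have : (fun N => q N * (Y N ^+ j.+1 - b ^+ j.+1) - z) @ \oo --> z - z.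
      by apply: cvgB; [exact: qY|exact: cvg_cst].
    apply: cvg_trans; apply: near_eq_cvg; exists 2%N => // N /= N2.
    have s2 := two_le_Re_nat N2.
    rewrite (dirichlet_sumB d1K (@bounded_point_mass R v z) s2).
    rewrite (dirichlet_sumB (cK _) (@bounded_point_mass R u _) s2).
    rewrite !dirichlet_sum_point_mass cpow// -/(X N) uE vE.
    rewrite monomialM ?expn_gt0// !monomialX// !monomial_nat// !(exprVn _ N).
    rewrite natrM natrX (exprMn N (_ ^+ j)) (exprAC _ j) /Y /q expr_div_n.
    by rewrite scaled_difference// expf_neq0// pnatr_eq0.
  split.
    have := d20 u (ltnW uv); rewrite d2E /point_mass eqxx (ltn_eqF uv) subr0.
    by move/eqP; rewrite subr_eq0 => /eqP.
  have := d20 v (leqnn _); rewrite d2E /point_mass eqxx (gtn_eqF uv) subr0.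
  by move/eqP; rewrite subr_eq0 => /eqP.
(* When [c 1] has no terms strictly between n and k, its coefficient at k is the leading one after
   removal of the term at n; this supplies the hypothesis of [Xpow]. *)
have next k : (n < k)%N -> (forall i, (n < i < k)%N -> c 1%N i = 0) ->
    (fun N => (k.+1%:R / n.+1%:R : Cplx R) ^+ N * (Y N - b)) @ \oo --> c 1%N k.
  move=> nk ck; pose d := c 1%N - point_mass n b.
  have dK := bounded_byB (cK 1%N) (@bounded_point_mass R n b).
  have dE i : d i = c 1%N i - point_mass n b i by [].
  have dk : d k = c 1%N k by rewrite dE /point_mass gtn_eqF// subr0.
  rewrite -dk; have := cvg_leading_coef dK; rewrite -/d => /(_ k) h.
  have {}h := h _; apply: cvg_trans (h _).
    apply: near_eq_cvg; exists 2%N => // N /= N2.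
    rewrite (dirichlet_sumB (cK _) (@bounded_point_mass R n b))
      ?two_le_Re_nat//.
    rewrite dirichlet_sum_point_mass monomial_nat// -/(X N) /Y.
    by rewrite expr_div_n exprVn; field; rewrite n1.
  move=> i ik; rewrite dE /point_mass; case: (ltngtP i n) => [i_n|n_i|->].
  - by rewrite c0// subr0.
  - by rewrite ck ?n_i// subr0.
  - by rewrite subrr.
have b1 : b = 1.
  apply: powers_near1 => -[|j]; first by rewrite expr0 subrr cmod0 invr_ge0.
  (* With k = n+1 no index lies in between, so [Xpow] applies at once and shows that every power of
     b is within 1/2 of 1. *)
  have gap i : (n < i < n.+1)%N -> c 1%N i = 0.
    by move=> /andP[h1 h2]; move: (leq_trans h1 h2); rewrite ltnn.
  have [cE _] := @Xpow n.+1 _ (leqnn _) (next _ (leqnn _) gap) j.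
  have := cnear j.+1 (n.+1 ^ j.+1).-1.
  by rewrite cE prednK ?expn_gt0// eqxx.
have c1 k : (n < k)%N -> c 1%N k = 0.
  elim/ltn_ind: k => k IH nk.
  have := next k nk (fun i h => IH i (proj2 (andP h)) (proj1 (andP h))).
  set a := c 1%N k => /(@Xpow k a nk) ck; apply/eqP; rewrite -cmod_eq0.
  apply/negPn/negP => a0.
  have a_gt0 : 0 < cmod a by rewrite lt0r a0 cmod_ge0.
  (* Since j > 1/|a|, the coefficient (j+1) a has modulus above 1. It sits at (n+1)^j (k+1), which
     differs from (n+1)^{j+1}, so it should be at most 1/2. *)
  pose j := Num.bound (cmod a)^-1.
  have := cnear j.+1 (n.+1 ^ j * k.+1).-1.
  rewrite (proj2 (ck j)) prednK ?muln_gt0 ?expn_gt0// expnSr.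
  rewrite eqn_pmul2l ?expn_gt0// eqSS gtn_eqF// subr0 b1 expr1n mulr1.
  rewrite cmodM cmod_nat; apply/negP; rewrite -ltNge.
  apply: (@lt_trans _ _ 1); first by lra.
  rewrite -ltr_pdivrMr// mul1r.
  apply: lt_trans (archi_boundP _) _; first by rewrite invr_ge0 ltW.
  by rewrite ltr_nat.
apply/funext => i; rewrite /point_mass; case: (ltngtP i n) => [i_n|n_i|->].
- exact: c0.
- exact: c1.
- exact: b1.
Qed.

End Uniqueness.

(** * Symbols of operators close to the identity *)

Section Rigidity.
Context (R : realType).
Implicit Types (s t : Cplx R).

Lemma unit_polar (x y : R) : x ^+ 2 + y ^+ 2 = 1 ->
  exists theta : R, cos theta = x /\ sin theta = y.
Proof.
move=> xy; have x1 : -1 <= x <= 1.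
  rewrite -ler_norml -(@expr_le1 _ 2%N) ?normr_ge0// real_normK ?num_real//.
  by rewrite -xy lerDl sqr_ge0.
have sx : sin (acos x) = `|y|.
  by rewrite sin_acos// -sqrtr_sqr -xy addrC addKr.
have [y0|y0] := leP 0 y.
  by exists (acos x); rewrite acosK ?inE//= sx ger0_norm.
by exists (- acos x); rewrite cosN acosK ?inE//= sinN sx ltr0_norm// opprK.
Qed.

Lemma ln2_gt0 : 0 < ln (2%:R : R).
Proof. by rewrite ln_gt0// ltr1n. Qed.

Lemma monomialD n s t : dirichlet_monomial n (s + t) =
  dirichlet_monomial n s * dirichlet_monomial n t.
Proof.
rewrite !monomial_polar; case: s => a b; case: t => c d /=.
rewrite natpowD mulrDl cosD sinD; apply/eqP.
by rewrite eq_complex /=; apply/andP; split; apply/eqP; ring.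
Qed.

Lemma monomial2_surj (w : Cplx R) : w != 0 ->
  exists s, dirichlet_monomial 2 s = w.
Proof.
move=> w0; have r0 : 0 < cmod w by rewrite lt0r cmod_eq0 w0 cmod_ge0.
have := ln2_gt0; set l := ln _ => l0.
(* [theta] is minus the argument of [w], because the imaginary part of 2^{-s} carries a minus
   sign. *)
have [theta [ct st]] : exists theta : R,
    cos theta = complex.Re w / cmod w /\ sin theta = - complex.Im w / cmod w.
  apply: unit_polar; rewrite !expr_div_n sqrrN -mulrDl.
  rewrite -[X in X / _](@sqr_sqrtr R) ?addr_ge0 ?sqr_ge0// -cmodE divff//.
  by rewrite expf_neq0// gt_eqF.
exists (- ln (cmod w) / l +i* (theta / l))%C.
rewrite /dirichlet_monomial /= -/l !divfK ?gt_eqF// opprK lnK ?posrE// ct st.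
rewrite !(mulrC (cmod w)) !divfK ?gt_eqF// opprK.
by case: (w).
Qed.

Definition period2 : Cplx R := (0 +i* (pi *+ 2 / ln 2%:R))%C.

Lemma monomial2_period : dirichlet_monomial 2 period2 = 1.
Proof.
rewrite /dirichlet_monomial /= mul0r oppr0 expR0 divfK ?gt_eqF ?ln2_gt0//.
rewrite cos2pi sin2pi; apply/eqP.
by rewrite eq_complex /= mulr0 mulr1 oppr0 !eqxx.
Qed.

(** The ratio ln 3 / ln 2 is not an integer: 2 < 3 < 4 places it strictly between 1 and 2. *)
Lemma monomial3_period : dirichlet_monomial 3 period2 != 1.
Proof.
apply/eqP => /(congr1 (@complex.Re R)).
rewrite /dirichlet_monomial /= mul0r oppr0 expR0 mul1r.
have := ln2_gt0; set l := ln _ => l0.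
(* Half the angle, less one half-turn. It lies in the open interval from 0 to pi, where the sine is
   positive, whereas cos(2h) = 1 would force sin h = 0. *)
pose h : R := pi * ((ln 3%:R - l) / l).
have -> : pi *+ 2 / l * ln 3%:R = h *+ 2 + pi *+ 2.
  by rewrite /h; field; rewrite gt_eqF.
rewrite cosD2pi cos_mulr2n => ch.
have : 0 < sin h.
  apply: sin_gt0_pi; rewrite /h mulr_gt0 ?pi_gt0//=; last first.
    by rewrite divr_gt0// subr_gt0 ltr_ln ?posrE ?ltr0n// ltr_nat.
  rewrite -[ltRHS]mulr1 ltr_pM2l ?pi_gt0// ltr_pdivrMr// mul1r.
  rewrite ltrBlDr -lnM ?posrE ?ltr0n// -natrM ltr_ln ?posrE ?ltr0n//.
  by rewrite ltr_nat.
have := cos2Dsin2 h; move: ch; move: (cos h) (sin h) => x y; nra.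
Qed.

(** The tail is itself a series vanishing before [M] with coefficients bounded by [L], so the
    estimate involves [L] alone; [K] serves to peel off the first terms one at a time. *)
Lemma dirichlet_sum_tail K L (a : dseries R) s M : bounded_by K a ->
  2 <= complex.Re s -> (forall i, (M <= i)%N -> cmod (a i) <= L) ->
  cmod (dirichlet_sum a s - \sum_(i < M) a i * dirichlet_monomial i.+1 s) <=
    2 * L * M.+1%:R ^+ 2 * natpow M.+1 (complex.Re s).
Proof.
move=> aK s2 aL; pose tail n : dseries R := fun i => if (i < n)%N then 0 else a i.
have tailK n : bounded_by K (tail n).
  move=> i; rewrite /tail; case: ifP => // _; rewrite cmod0.
  exact: le_trans (cmod_ge0 _) (aK 0%N).
have -> : dirichlet_sum a s - \sum_(i < M) a i * dirichlet_monomial i.+1 s =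
    dirichlet_sum (tail M) s.
  elim: M {aL} => [|M IH]; first by rewrite big_ord0 subr0.
  rewrite big_ord_recr /= opprD addrA IH -dirichlet_sum_point_mass.
  rewrite -(dirichlet_sumB (tailK M) (@bounded_point_mass _ M (a M)))//.
  congr dirichlet_sum; apply/funext => i.
  rewrite [LHS]/GRing.add /= [X in _ + X]/GRing.opp /= /tail /point_mass ltnS.
  by case: (ltngtP i M) => [||->]; rewrite ?subr0 ?subrr.
apply: dirichlet_sum_le => // [i|i iM]; last by rewrite /tail iM.
rewrite /tail; case: ltnP => [_|]; last exact: aL.
by rewrite cmod0; apply: le_trans (cmod_ge0 _) (aL M (leqnn _)).
Qed.

(** * The images of the monomials under an operator close to the identity *)

Section Symbol.
Context (eps : R) (A : nat -> dseries R) (Phi : Cplx R -> Cplx R).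
Hypothesis eps_le : eps <= 8^-1.
Hypothesis A_near : forall n i, cmod (A n i - (i == n)%:R) <= eps.
Hypothesis A_sum : forall n s, 2 <= complex.Re s ->
  dirichlet_sum (A n) s = dirichlet_monomial n.+1 (Phi s).
Hypothesis Phi_ge0 : forall s, 2 <= complex.Re s -> 0 <= complex.Re (Phi s).

Let A_bounded n : bounded_by (eps + 1) (A n).
Proof.
move=> i; rewrite -[A n i](subrK (i == n)%:R).
apply: le_trans (cmodD _ _) (lerD (A_near n i) _).
by rewrite cmod_nat; case: (i == n).
Qed.

Let A_small n i : i != n -> cmod (A n i) <= eps.
Proof. by move=> /negbTE ni; have := A_near n i; rewrite ni subr0. Qed.

Let eps_ge0 : 0 <= eps.
Proof. exact: le_trans (cmod_ge0 _) (A_near 0 0). Qed.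

Let A_diag n : 7 / 8 <= cmod (A n n).
Proof.
have h : cmod (A n n - 1) <= eps by have := A_near n n; rewrite eqxx.
have := cmodB (A n n) (A n n - 1).
by rewrite opprB addrC subrK cmod1; have := eps_le; lra.
Qed.

(* At a zero [s] of [a_1 + a_2 2^{-s}], where [a = A 1], the value
   [2^{-Phi s}] is of order [eps 3^{-Re s}], hence so is the smaller
   [3^{-Phi s}]. The zeros have period [2 pi i / ln 2], whereas the dominant
   [3^{-s}] changes over one period by a fixed factor other than 1. *)
Lemma symbol_leading2 :
  100 * eps < 2^-1 * cmod (1 - dirichlet_monomial 3 period2 : Cplx R) ->
  A 1%N 0%N = 0.
Proof.
set omega := dirichlet_monomial 3 period2 => epsw.
apply/eqP/negPn/negP => b0.
set b := A 1%N 0%N in b0; set u := A 1%N 1%N.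
have u78 : 7 / 8 <= cmod u by exact: A_diag.
have e0 := eps_ge0; have e8 := eps_le.
have u0 : u != 0 by rewrite -cmod_eq0; lra.
have [s0 s0E] : exists s, dirichlet_monomial 2 s = - b / u.
  by apply: monomial2_surj; rewrite mulf_neq0 ?oppr_eq0 ?invr_eq0.
(* The constant is 50 = 18 + 32: 18 = 2 * 3^2 bounds 2^{-Phi(s)}, a tail after two terms since those
   cancel at [s], and 32 = 2 * 4^2 bounds the tail of 3^{-Phi(s)} after three terms. *)
have near_zero s : dirichlet_monomial 2 s = - b / u -> cmod
    (A 2 0%N + A 2 1%N * (- b / u) + A 2 2 * dirichlet_monomial 3 s) <=
    50 * eps * natpow 3 (complex.Re s).
  (* The modulus of 2^{-s} is |b/u| <= (1/8)/(7/8), which is below 2^{-2}. *)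
  move=> sE; have s2 : 2 <= complex.Re s.
    rewrite -(@ler_pM2r _ (ln (2%:R : R))) ?ln2_gt0// -lerN2 -ler_expR.
    rewrite -/(natpow 2 _) -/(natpow 2 _) natpow_nat// -cmod_monomial sE.
    rewrite cmodM cmodN cmodV ler_pdivrMr; last by lra.
    by have := @A_small 1 0 isT; rewrite -/b; have := eps_le; lra.
  have h1 := @dirichlet_sum_tail _ eps _ s 2 (A_bounded 1) s2.
  have h2 := @dirichlet_sum_tail _ eps _ s 3 (A_bounded 2) s2.
  have {}h1 : cmod (dirichlet_monomial 2 (Phi s)) <=
      18 * eps * natpow 3 (complex.Re s).
    move: h1; rewrite !big_ord_recr big_ord0 /= add0r monomial1 mulr1 -/b -/u sE.
    rewrite (mulrC u) divfK// addrN subr0 A_sum//.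
    rewrite (_ : 2 * eps * 3 ^+ 2 = 18 * eps); last by ring.
    by apply=> i i2; apply: A_small; rewrite gtn_eqF.
  have {}h2 : cmod (dirichlet_monomial 3 (Phi s) -
      (A 2 0%N + A 2 1%N * (- b / u) + A 2 2 * dirichlet_monomial 3 s)) <=
      32 * eps * natpow 4 (complex.Re s).
    move: h2; rewrite !big_ord_recr big_ord0 /= add0r monomial1 mulr1 sE A_sum//.
    rewrite (_ : 2 * eps * 4 ^+ 2 = 32 * eps); last by ring.
    by apply=> i i2; apply: A_small; rewrite gtn_eqF.
  have h3 : cmod (dirichlet_monomial 3 (Phi s)) <=
      cmod (dirichlet_monomial 2 (Phi s)).
    by rewrite !cmod_monomial natpow_le// Phi_ge0.
  have h4 : 32 * eps * natpow 4 (complex.Re s) <=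
      32 * eps * natpow 3 (complex.Re s).
    by apply: ler_wpM2l; [lra|rewrite natpow_le//; lra].
  set X := _ + _ + _ in h2 *; set Y := dirichlet_monomial 3 _ in h2 h3.
  rewrite -(subKr Y X); apply: le_trans (cmodB _ _) _.
  apply: le_trans (lerD (le_trans h3 h1) (le_trans h2 h4)) _.
  by rewrite -mulrDl; apply: ler_wpM2r; [exact/ltW/natpow_gt0|lra].
have s1E : dirichlet_monomial 2 (s0 + period2) = - b / u.
  by rewrite monomialD monomial2_period mulr1.
have reE : complex.Re (s0 + period2) = complex.Re s0.
  by case: (s0) => x y /=; rewrite addr0.
(* Subtracting the two instances cancels the terms at bases 1 and 2. What remains is A_2(2) 3^{-s0}
   (1 - omega), of size at most 100 eps 3^{-Re s0}, against |A_2(2)| >= 7/8. *)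
have := lerD (near_zero _ s0E) (near_zero _ s1E).
rewrite reE monomialD -/omega; set c := _ + A 2 1%N * _.
set m3 := dirichlet_monomial 3 s0 => h.
have {h} := le_trans (cmodB _ _) h.
rewrite (_ : _ - _ = A 2 2 * m3 * (1 - omega)); last by ring.
rewrite !cmodM -mulrDl /m3 cmod_monomial.
rewrite -mulrA mulrCA mulrC ler_pM2r ?natpow_gt0//.
have := A_diag 2; have := cmod_ge0 (1 - omega); nra.
Qed.

Lemma symbol_rigid :
  100 * eps < 2^-1 * cmod (1 - dirichlet_monomial 3 period2 : Cplx R) ->
  forall n, A n = point_mass n 1.
Proof.
move=> epsw.
have rigid n : (forall i, (i < n)%N -> A n i = 0) -> A n = point_mass n 1.
  move=> An0; have nE j : (n.+1 ^ j).-1.+1 = (n.+1 ^ j)%N.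
    by rewrite prednK ?expn_gt0.
  (* The j-th power of (n+1)^{-Phi(s)} is the image of the monomial of base (n+1)^j, whose index is
     (n+1)^j - 1. *)
  have := @power_rigidity R n (fun j => A (n.+1 ^ j).-1); rewrite expn1; apply=> //.
    move=> j i; rewrite -nE eqSS; apply: le_trans (A_near _ _) _.
    by apply: le_trans eps_le _; lra.
  move=> j N N2; have s2 := @two_le_Re_nat R N N2.
  by rewrite !A_sum// nE monomialX.
have A1 : A 1%N = point_mass 1 1.
  apply: rigid => i; rewrite ltnS leqn0 => /eqP ->.
  exact: symbol_leading2.
have RePhi N : (2 <= N)%N -> complex.Re (Phi (N%:R : Cplx R)) = N%:R.
  move=> N2; have s2 := @two_le_Re_nat R N N2.
  have := A_sum 1%N s2; rewrite A1 dirichlet_sum_point_mass mul1r.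
  move/(congr1 (@cmod R)); rewrite !cmod_monomial => /expR_inj/oppr_inj.
  by rewrite (ReIm_nat _ N).1 => /(mulIf (lt0r_neq0 ln2_gt0)) ->.
move=> n; apply: rigid => i; case: n => // n; rewrite ltnS => i_n.
(* Since Re Phi(N) = N, the value of [A n.+1] at N has modulus (n+2)^{-N}, which is negligible
   against (n+1)^{-N}. *)
apply: (@coef_eq0 _ _ (A n.+1) n (@A_bounded n.+1)) i_n.
apply: (@cvg_cmod_le _ _ _ (fun N => (n.+1%:R / n.+2%:R) ^+ N)); last first.
  exact: cvg_ratio_pow.
exists 2%N => // N /= N2; have s2 := @two_le_Re_nat R N N2.
rewrite subr0 A_sum// cmodM cmodX cmod_nat cmod_monomial RePhi// natpow_nat//.
by rewrite exprMn.
Qed.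

End Symbol.

End Rigidity.

(** * Fourier coefficients and the Hardy space *)

Section TorusMeasurability.
Context (R : realType).
Implicit Types (F G : torus R -> Cplx R).

Lemma Re_continuous : continuous (@complex.Re R : Cplx R -> R).
Proof.
move=> w; apply/(@cvgrPdist_lt _ _ _ (nbhs (w : Cplx R))) => e e0.
apply/nbhs_ballP; exists e%:C%C; first by rewrite /= ltcR.
move=> z; rewrite -ball_normE /= => h; have {}h : cmod (w - z) < e.
  by rewrite -ltcR -norm_cmod.
apply: le_lt_trans h; apply: le_trans (abs_Re_le _).
by case: (w) => ? ?; case: (z).
Qed.

Lemma Im_continuous : continuous (@complex.Im R : Cplx R -> R).
Proof.
move=> w; apply/(@cvgrPdist_lt _ _ _ (nbhs (w : Cplx R))) => e e0.
apply/nbhs_ballP; exists e%:C%C; first by rewrite /= ltcR.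
move=> z; rewrite -ball_normE /= => h; have {}h : cmod (w - z) < e.
  by rewrite -ltcR -norm_cmod.
apply: le_lt_trans h; apply: le_trans (abs_Im_le _).
by case: (w) => ? ?; case: (z).
Qed.

Lemma measurable_coord (f : Cplx R -> R) (j : nat) : continuous f ->
  measurable_fun setT (fun z : torus R => f (val (z j))).
Proof.
move=> /continuousP cf; apply: (measurability _ (RGenOpens.measurableE R)).
move=> _ [_ [a [b ->] <-]]; rewrite setTI; apply: sub_sigma_algebra.
exists j, (f @^-1` `]a, b[%classic); split => //.
by apply: cf; exact: interval_open.
Qed.

Lemma measurable_rotation (w : torus R) : measurable_fun setT (rotation w).
Proof.
apply: (@measurability _ _ (torus R) (torus R) setT (rotation w)
  (@torus_cylinders R)) => // _ [_ [j [U [oU ->]] <-]].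
rewrite setTI; apply: sub_sigma_algebra.
exists j, ((fun x : Cplx R => (val (w j) : Cplx R) * x) @^-1` U); split => //.
move: U oU; apply/continuousP => x.
apply: (@cvgM R[i] (Cplx R) (nbhs x) _ (cst (val (w j))) id).
  exact: cvg_cst.
exact: cvg_id.
Qed.

Definition cmeasurable F :=
  measurable_fun setT (fun z => complex.Re (F z)) /\
  measurable_fun setT (fun z => complex.Im (F z)).

Lemma cmeasurableM F G : cmeasurable F -> cmeasurable G ->
  cmeasurable (fun z => F z * G z).
Proof.
move=> [rF iF] [rG iG].
have reE z : complex.Re (F z * G z) = complex.Re (F z) * complex.Re (G z) -
  complex.Im (F z) * complex.Im (G z) by case: (F z) => ? ?; case: (G z).
have imE z : complex.Im (F z * G z) = complex.Re (F z) * complex.Im (G z) +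
  complex.Im (F z) * complex.Re (G z) by case: (F z) => ? ?; case: (G z).
split; [rewrite (funext reE)|rewrite (funext imE)].
- by apply: measurable_funB; exact: measurable_funM.
- by apply: measurable_funD; exact: measurable_funM.
Qed.

Lemma cmeasurable_conj F : cmeasurable F -> cmeasurable (fun z => (F z)^*%C).
Proof.
move=> [rF iF].
have reE z : complex.Re (F z)^*%C = complex.Re (F z) by case: (F z).
have imE z : complex.Im (F z)^*%C = - complex.Im (F z) by case: (F z).
split; [rewrite (funext reE)|rewrite (funext imE)] => //.
exact: measurable_funN.
Qed.

Lemma cmeasurableB F G : cmeasurable F -> cmeasurable G ->
  cmeasurable (fun z => F z - G z).
Proof.
move=> [rF iF] [rG iG].
have reE z : complex.Re (F z - G z) = complex.Re (F z) - complex.Re (G z)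
  by case: (F z) => ? ?; case: (G z).
have imE z : complex.Im (F z - G z) = complex.Im (F z) - complex.Im (G z)
  by case: (F z) => ? ?; case: (G z).
split; [rewrite (funext reE)|rewrite (funext imE)];
  exact: measurable_funB.
Qed.

Lemma cmeasurable_cst (c : Cplx R) : cmeasurable (fun _ => c).
Proof. by split; exact: measurable_cst. Qed.

Lemma measurable_cmod F : cmeasurable F ->
  measurable_fun setT (fun z => cmod (F z)).
Proof.
move=> [rF iF]; rewrite (funext (fun z => cmodE (F z))).
apply: (@measurableT_comp _ _ _ _ _ _ (@Num.sqrt R)).
  by apply: continuous_measurable_fun; exact: sqrt_continuous.
by apply: measurable_funD; exact: measurable_funX.
Qed.

Lemma circle_invE (x : circle R) : (val x : R[i])^-1 = (val x)^*%C.
Proof.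
have /eqP := valP x; case: (val x) => a b; rewrite cmodE /=.
move/(congr1 (fun y => y ^+ 2)); rewrite sqr_sqrtr ?addr_ge0 ?sqr_ge0// expr1n.
by move=> h; apply/eqP; rewrite eq_complex /= h !divr1 !eqxx.
Qed.

Lemma cmeasurable_coordX (j : nat) (l : int) :
  cmeasurable (fun z : torus R => (val (z j) : R[i]) ^ l).
Proof.
have powM n : cmeasurable (fun z : torus R => (val (z j) : R[i]) ^+ n).
  elim: n => [|n IH]; first exact: cmeasurable_cst.
  rewrite (funext (fun z : torus R => exprS (val (z j) : R[i]) n)).
  apply: cmeasurableM => //.
  by split; apply: measurable_coord; [exact: Re_continuous|exact: Im_continuous].
case: l => n; first exact: powM.
(* On the circle the inverse is the conjugate, which reduces negative exponents to positive ones. *)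
have -> : (fun z : torus R => (val (z j) : R[i]) ^ Negz n) =
    (fun z => ((val (z j) : R[i]) ^+ n.+1)^*%C).
  apply/funext => z; rewrite rmorphXn /= -circle_invE.
  by rewrite NegzE -exprnN exprVn.
exact: cmeasurable_conj.
Qed.

Lemma cmeasurable_character k : cmeasurable (@character R k).
Proof.
rewrite /character; elim: (enum_fset (finsupp k)) => [|j s IH].
  by rewrite (funext (fun z => big_nil _ _ _ _)); exact: cmeasurable_cst.
rewrite (funext (fun z => big_cons _ _ _ _ _ _)); apply: cmeasurableM => //.
exact: cmeasurable_coordX.
Qed.

Lemma cmod_conj (x : Cplx R) : cmod (x^*%C : Cplx R) = cmod x.
Proof. by case: x => a b; rewrite !cmodE /= sqrrN. Qed.

Lemma cmod_character k z : cmod (character k z : Cplx R) = 1.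
Proof.
rewrite /character; elim/big_ind : _ => [|x y x1 y1|j _]; first exact: cmod1.
  by rewrite cmodM x1 y1 mulr1.
have /eqP z1 := valP (z j); case: (k j) => n.
  by rewrite cmodX z1 expr1n.
by rewrite NegzE -exprnN cmodV cmodX z1 expr1n invr1.
Qed.

Lemma mul_conj_unit (x : Cplx R) : cmod x = 1 -> x * x^*%C = 1.
Proof.
case: x => a b; rewrite cmodE /=.
move/(congr1 (fun y => y ^+ 2)); rewrite sqr_sqrtr ?addr_ge0 ?sqr_ge0// expr1n.
move=> h; apply/eqP; rewrite eq_complex /=; apply/andP; split; apply/eqP.
  by rewrite -h; ring.
by ring.
Qed.

Lemma character_rotation k (w z : torus R) :
  character k (rotation w z) = character k w * character k z.
Proof.
by rewrite /character -big_split /=; apply: eq_bigr => j _; rewrite expfzMl.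
Qed.

End TorusMeasurability.

(** * Complex integrals on the torus and bounds for Fourier coefficients *)

Section TorusIntegration.
Context (R : realType) (m : probability (torus R) R).
Implicit Types (F G : torus R -> Cplx R) (p : R).

Definition cintegrable F :=
  m.-integrable setT (EFin \o (fun z => complex.Re (F z))) /\
  m.-integrable setT (EFin \o (fun z => complex.Im (F z))).

Lemma cintegrable_le F G : cmeasurable G ->
  m.-integrable setT (EFin \o (fun z => cmod (F z))) ->
  (forall z, cmod (G z) <= cmod (F z)) -> cintegrable G.
Proof.
move=> [rG iG] iF GF; split; apply: (le_integrable _ _ _ iF) => //.
- exact/measurable_EFinP.
- move=> z _ /=; rewrite lee_fin (ger0_norm (cmod_ge0 _)).
  exact: le_trans (abs_Re_le _) (GF z).
- exact/measurable_EFinP.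
- move=> z _ /=; rewrite lee_fin (ger0_norm (cmod_ge0 _)).
  exact: le_trans (abs_Im_le _) (GF z).
Qed.

(** The factor 2 comes from estimating real and imaginary parts separately. *)
Lemma cmod_cintegral_le F G : cmeasurable G ->
  m.-integrable setT (EFin \o (fun z => cmod (F z))) ->
  (forall z, cmod (G z) <= cmod (F z)) ->
  cmod (cintegral m G) <= 2 * \int[m]_z cmod (F z).
Proof.
move=> mG iF GF; have [irG iiG] := cintegrable_le mG iF GF.
apply: le_trans (cmod_le_ReIm _) _; rewrite /= mulrDl mul1r.
apply: lerD; (apply: le_trans; first exact: le_normr_Rintegral);
  apply: le_Rintegral => //.
- exact: (integrable_norm irG).
- by move=> z _; exact: le_trans (abs_Re_le _) (GF z).
- exact: (integrable_norm iiG).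
- by move=> z _; exact: le_trans (abs_Im_le _) (GF z).
Qed.

Lemma cintegralB F G : cintegrable F -> cintegrable G ->
  cintegral m (fun z => F z - G z) = cintegral m F - cintegral m G.
Proof.
move=> [rF iF] [rG iG].
have reE z : complex.Re (F z - G z) = complex.Re (F z) - complex.Re (G z)
  by case: (F z) => ? ?; case: (G z).
have imE z : complex.Im (F z - G z) = complex.Im (F z) - complex.Im (G z)
  by case: (F z) => ? ?; case: (G z).
rewrite /cintegral (funext reE) (funext imE) !RintegralB//.
Qed.

Lemma cintegralZ (c : Cplx R) F : cintegrable F ->
  cintegral m (fun z => c * F z) = c * cintegral m F.
Proof.
move=> [rF iF]; case: c => a b.
have reE z : complex.Re ((a +i* b)%C * F z) =
  a * complex.Re (F z) - b * complex.Im (F z) by case: (F z).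
have imE z : complex.Im ((a +i* b)%C * F z) =
  a * complex.Im (F z) + b * complex.Re (F z) by case: (F z).
have intZ (x : R) (f : torus R -> R) : m.-integrable setT (EFin \o f) ->
    m.-integrable setT (EFin \o (fun z => x * f z)).
  by move=> fi; exact: (integrableZl _ x fi).
rewrite /cintegral (funext reE) (funext imE) RintegralB ?RintegralD//;
  try exact: intZ.
by rewrite !RintegralZl.
Qed.

(** Hoelder's inequality against the constant 1, whose norm is 1 for a probability; p = 1, with its
    infinite conjugate exponent, is treated apart. *)
Lemma L1_le_Lp (f : torus R -> R) p : measurable_fun setT f -> 1 <= p ->
  (\int[m]_z `|f z|%:E <= 'N[m]_p%:E[EFin \o f])%E.
Proof.
move=> mf; rewrite le_eqVlt => /predU1P[<-|p1]; first by rewrite Lnorm1.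
have p0 : 0 < p by exact: lt_trans p1.
pose q := (1 - p^-1)^-1.
have q0 : 0 < q by rewrite invr_gt0 subr_gt0 invf_lt1.
have := @hoelder _ _ _ m f (cst 1) p q mf (@measurable_cst _ _ _ _ _ _) p0 q0.
rewrite /q invrK addrC subrK => /(_ erefl).
rewrite Lnorm_cst1 [X in (X `^ _)%E](_ : _ = 1%E); last exact: probability_setT.
rewrite poweR1r mule1 Lnorm1.
by apply: le_trans; rewrite le_eqVlt; apply/orP; left; apply/eqP;
  apply: eq_integral => z _ /=; rewrite mulr1.
Qed.

Lemma in_Lp_integrable p F : 1 <= p -> in_Lp m p F ->
  m.-integrable setT (EFin \o (fun z => cmod (F z))).
Proof.
move=> p1 [rF iF Fp]; have mF := measurable_cmod (conj rF iF).
apply/integrableP; split; first exact/measurable_EFinP.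
exact: le_lt_trans (L1_le_Lp mF p1) Fp.
Qed.

Lemma cmod_fourier_le p F k : 1 <= p -> in_Lp m p F ->
  ((cmod (fourier m F k))%:E <= 2%:E * Lp_norm m p F)%E.
Proof.
move=> p1 FLp; have iF := in_Lp_integrable p1 FLp.
have [rF imF Fp] := FLp; have mF := measurable_cmod (conj rF imF).
have FX z : cmod (F z * (character k z)^*%C) <= cmod (F z).
  by rewrite cmodM cmod_conj cmod_character mulr1.
have mX : cmeasurable (fun z => F z * (character k z)^*%C).
  by apply: cmeasurableM => //; exact/cmeasurable_conj/cmeasurable_character.
have := cmod_cintegral_le mX iF FX; rewrite -lee_fin => /le_trans; apply.
rewrite EFinM lee_pmul2l//.
apply: le_trans (L1_le_Lp mF p1); rewrite fineK.
  rewrite le_eqVlt; apply/orP; left; apply/eqP; apply: eq_integral => z _.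
  by rewrite ger0_norm ?cmod_ge0.
exact: integrable_fin_num.
Qed.

End TorusIntegration.

(** * Differences and coefficient bounds in the Hardy space, and rotation invariance *)

Section HardySpace.
Context (R : realType) (m : probability (torus R) R).
Implicit Types (F G : torus R -> Cplx R) (p : R).

Lemma le_Lnorm (f g : torus R -> R) p : 0 < p ->
  measurable_fun setT f -> measurable_fun setT g ->
  (forall z, `|f z| <= `|g z|) ->
  ('N[m]_p%:E[EFin \o f] <= 'N[m]_p%:E[EFin \o g])%E.
Proof.
move=> p0 mf mg fg; rewrite unlock /Lnorm.
have int0 (h : torus R -> R) :
    (\int[m]_z `|(EFin \o h) z| `^ p \in `[0, +oo])%E.
  by rewrite in_itv /= leey integral_ge0// => z _; exact: poweR_ge0.
apply: gt0_ler_poweR; rewrite ?invr_ge0 ?(ltW p0)//.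
have mp (h : torus R -> R) : measurable_fun setT h ->
    measurable_fun setT (fun z => (`|h z| `^ p)%:E).
  move=> mh; apply/measurable_EFinP.
  by apply: (measurableT_comp (measurable_powR _)); exact: measurableT_comp.
apply: ge0_le_integral => //.
- by move=> z _; exact: poweR_ge0.
- exact: mp.
- exact: mp.
- by move=> z _ /=; rewrite lee_fin ge0_ler_powR ?nnegrE// ltW.
Qed.

Lemma in_LpB p F G : 1 <= p -> in_Lp m p F -> in_Lp m p G ->
  in_Lp m p (fun z => F z - G z).
Proof.
move=> p1 [rF iF Fp] [rG iG Gp].
have [rH iH] := cmeasurableB (conj rF iF) (conj rG iG).
have mF := measurable_cmod (conj rF iF).
have mG := measurable_cmod (conj rG iG).
split => //; apply: (@le_lt_trans _ _ (Lp_norm m p F + Lp_norm m p G)%E).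
  apply: le_trans (minkowski_EFin m mF mG p1).
  apply: le_Lnorm; first exact: lt_le_trans p1.
  - exact: measurable_cmod.
  - exact: measurable_funD.
  move=> z; rewrite !ger0_norm ?addr_ge0 ?cmod_ge0//.
  exact: cmodB.
by rewrite lte_add_pinfty.
Qed.

Lemma cintegrable_fourier p F k : 1 <= p -> in_Lp m p F ->
  cintegrable m (fun z => F z * (character k z)^*%C).
Proof.
move=> p1 FLp; apply: (@cintegrable_le _ _ F).
- have [rF iF _] := FLp; apply: cmeasurableM => //.
  exact/cmeasurable_conj/cmeasurable_character.
- exact: in_Lp_integrable FLp.
- by move=> z; rewrite cmodM cmod_conj cmod_character mulr1.
Qed.

Lemma fourierB p F G k : 1 <= p -> in_Lp m p F -> in_Lp m p G ->
  fourier m (fun z => F z - G z) k = fourier m F k - fourier m G k.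
Proof.
move=> p1 FLp GLp; rewrite /fourier -cintegralB; last 2 first.
- exact: cintegrable_fourier FLp.
- exact: cintegrable_fourier GLp.
by congr cintegral; apply/funext => z; rewrite mulrBl.
Qed.

Lemma hardyB p f g : 1 <= p -> hardy m p f -> hardy m p g -> hardy m p (f - g).
Proof.
move=> p1 [F [[FLp F0] Ff]] [G [[GLp G0] Gg]].
exists (fun z => F z - G z); split; first split.
- exact: in_LpB.
- by move=> k kneg; rewrite (fourierB k p1 FLp GLp) F0// G0// subrr.
- by move=> n; rewrite (fourierB _ p1 FLp GLp) Ff Gg.
Qed.

(** The bound holds for every lift of [f], hence for the infimum over lifts; this infimum is finite
    because some lift exists, so [fine] does not alter it. *)
Lemma coef_le_hardy_norm p f n : 1 <= p -> hardy m p f ->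
  cmod (f n) <= 2 * hardy_norm m p f.
Proof.
move=> p1 [F0 F0f]; rewrite -ler_pdivrMl//.
have inf_ge : ((2^-1 * cmod (f n))%:E <=
    ereal_inf [set Lp_norm m p F | F in bohr_lift m p f])%E.
  apply: le_ereal_inf_tmp => _ [F [[FLp _] Ff] <-].
  have := cmod_fourier_le (kappa n.+1) p1 FLp; rewrite Ff => h.
  by rewrite EFinM lee_pdivrMl.
rewrite -lee_fin /hardy_norm fineK// ge0_fin_numE.
  apply: le_lt_trans (ereal_inf_lbound _) _; first by exists F0; [|reflexivity].
  by case: F0f => -[[]].
by apply: le_trans inf_ge; rewrite lee_fin mulr_ge0 ?cmod_ge0.
Qed.

Lemma hardy_bounded p f : 1 <= p -> hardy m p f ->
  bounded_by (2 * hardy_norm m p f) f.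
Proof. by move=> p1 fp n; exact: coef_le_hardy_norm. Qed.

Hypothesis haar : is_haar m.

(** [is_haar] says that the image of m under a rotation is m; the change of variables for image
    measures carries this over to integrals. *)
Lemma cintegral_rotation (w : torus R) F : cmeasurable F ->
  cintegrable m (F \o rotation w) ->
  cintegral m (F \o rotation w) = cintegral m F.
Proof.
have inv (f : torus R -> R) : measurable_fun setT f ->
    m.-integrable setT (EFin \o (f \o rotation w)) ->
    \int[m]_z (f \o rotation w) z = \int[m]_z f z.
  move=> mf fi; rewrite /Rintegral; congr fine.
  have mr := @measurable_rotation R w.
  have mfE : measurable_fun setT (EFin \o f) by exact/measurable_EFinP.
  have := @integral_pushforward _ _ _ _ _ _ mr m setT _ mfE.
  rewrite preimage_setT => /(_ fi measurableT) <-.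
  apply: eq_measure_integral => A mA _.
  exact: haar.
by move=> [rF iF] [rFi iFi]; rewrite /cintegral; congr (_ +i* _)%C; exact: inv.
Qed.

End HardySpace.

(** * Separating characters and injectivity of prime factorisation *)

Section Characters.
Context (R : realType).

Lemma de_moivre (theta : R) n :
  (cos theta +i* sin theta)%C ^+ n = (cos (theta *+ n) +i* sin (theta *+ n))%C.
Proof.
elim: n => [|n IH]; first by rewrite expr0 mulr0n cos0 sin0.
rewrite exprS IH mulrS cosD sinD; apply/eqP.
by rewrite eq_complex /=; apply/andP; split; apply/eqP; ring.
Qed.

Lemma circle_expz_neq1 (l : int) : l != 0 ->
  exists v : circle R, (val v : R[i]) ^ l != 1.
Proof.
(* With v = exp(i pi / |l|), the power v^{|l|} is -1, and so is its inverse. *)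
move=> l0; pose theta : R := pi / `|l|%N%:R.
have l1 : (`|l|%N%:R : R) != 0 by rewrite pnatr_eq0 absz_eq0.
have v1 : cmod ((cos theta +i* sin theta)%C : Cplx R) == 1.
  by rewrite cmodE /= cos2Dsin2 sqrtr1.
exists (exist (fun z : Cplx R => cmod z == 1) _ v1); rewrite /= -/theta.
have vl : (cos theta +i* sin theta)%C ^+ `|l|%N = -1.
  rewrite de_moivre -mulr_natr divfK// cospi sinpi.
  by apply/eqP; rewrite eq_complex /= oppr0 !eqxx.
have N1 : (-1 : R[i]) != 1 by rewrite eqr_oppLR -addr_eq0 -mulr2n pnatr_eq0.
move: (_ +i* _)%C vl {v1 l1} => v; case: l {theta l0} => n /= vl.
  by rewrite -[v ^ _]/(v ^+ n) vl.
by rewrite NegzE -exprnN [v ^+ _]vl invrN1.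
Qed.

(** The default [point] of the circle is 1, so a character sees only coordinate [j0]. *)
Definition single (j0 : nat) (v : circle R) : torus R :=
  fun j => if j == j0 then v else point.

Lemma character_single k j0 v :
  character k (single j0 v) = (val v : R[i]) ^ k j0.
Proof.
rewrite /character; have [j0k|j0k] := boolP (j0 \in finsupp k).
  rewrite (big_fsetD1 j0)//= big1_seq ?mulr1; first by rewrite /single eqxx.
  move=> j /=; rewrite in_fsetD1 /single => /andP[/negbTE ->] _.
  exact: exp1rz.
rewrite big1_seq => [|j /= jk]; first by rewrite fsfun_dflt// expr0z.
rewrite /single ifN; first exact: exp1rz.
by apply: contraNneq j0k => <-.
Qed.

(** At the least j with q <= [nth_prime j], the previous prime in the list is below q, and
    [next_prime] picks the smallest prime beyond it, hence at most q. *)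
Lemma nth_prime_surj q : prime q -> exists j, nth_prime j = q.
Proof.
move=> qP; have ex : exists j, (q <= nth_prime j)%N.
  by exists q; exact/ltnW/nth_prime_gt.
case: (ex_minnP ex) => -[|j] qj min.
  by exists 0; apply/eqP; rewrite eqn_leq qj andbT; exact: prime_gt1.
exists j.+1; apply/eqP; rewrite eqn_leq qj andbT.
rewrite /nth_prime iterS -/(nth_prime j) /next_prime.
case: ex_minnP => r _; apply; rewrite qP andbT ltnNge.
by apply/negP => /min; rewrite ltnn.
Qed.

Lemma kappa_inj n k : (0 < n)%N -> (0 < k)%N -> kappa n = kappa k -> n = k.
Proof.
move=> n0 k0 nk; apply: eqn_from_log => // q.
have [qP|qP] := boolP (prime q); last by rewrite (lognE q n) (lognE q k) (negbTE qP).
have [j <-] := nth_prime_surj qP.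
by have := congr1 (fun f : {fsfun nat -> int with 0} => f j) nk;
  rewrite !kappaE// => -[].
Qed.

Lemma kappa_ge0 n j : 0 <= kappa n.+1 j.
Proof. by rewrite kappaE. Qed.

End Characters.

(** * The monomials as elements of the Hardy space *)

Section Monomials.
Context (R : realType) (m : probability (torus R) R) (p : R).
Hypotheses (haar : is_haar m) (p1 : 1 <= p).

Lemma character_in_Lp k : in_Lp m p (@character R k) /\
  Lp_norm m p (@character R k) = 1%E.
Proof.
have [rX iX] := @cmeasurable_character R k.
have N1 : Lp_norm m p (@character R k) = 1%E.
  rewrite /Lp_norm (@eq_Lnorm _ _ _ _ _ _ (cst 1%E)); last first.
    by move=> z /=; rewrite cmod_character.
  have := @Lnorm_cst1 _ _ _ m p; rewrite [X in (X `^ _)%E](_ : _ = 1%E).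
    by rewrite poweR1r.
  exact: probability_setT.
by split => //; split => //; rewrite N1 ltry.
Qed.

(** If k and l differ at [j0], rotating that coordinate by v multiplies the integrand by v^{k(j0) -
    l(j0)}. For v making this factor different from 1, invariance of the integral forces it to be
    0. *)
Lemma fourier_character k l :
  fourier m (@character R k) l = if k == l then 1 else 0.
Proof.
rewrite /fourier; set G := fun z => _.
have [E|kl] := eqVneq k l.
  rewrite (_ : G = fun=> 1).
    rewrite /cintegral /= !Rintegral_cst//.
    by rewrite [X in fine X](_ : _ = 1%E) ?mul1r ?mul0r//; exact: probability_setT.
  by apply/funext => z; rewrite /G E mul_conj_unit// cmod_character.
have [j0 klj] : exists j0, k j0 != l j0.
  apply: contrapT => h; move/eqP: kl; apply; apply/fsfunP => j.
  by apply/eqP/negPn/negP => jP; apply: h; exists j.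
have kl0 : k j0 - l j0 != 0 by rewrite subr_eq0.
have [v v1] := @circle_expz_neq1 R _ kl0.
have vU : (val v : R[i]) != 0.
  by have /eqP v1' := valP v; rewrite -cmod_eq0 v1' oner_eq0.
have G1 z : cmod (G z) = 1.
  by rewrite /G cmodM cmod_conj !cmod_character mulr1.
have mG : cmeasurable G.
  apply: cmeasurableM; first exact: cmeasurable_character.
  exact/cmeasurable_conj/cmeasurable_character.
have iG : cintegrable m G.
  exact: cintegrable_fourier (character_in_Lp k).1.
pose w := single j0 v.
have Gw : G \o rotation w = (fun z => (val v : R[i]) ^ (k j0 - l j0) * G z).
  apply/funext => z; rewrite /G /= !character_rotation !character_single.
  rewrite expfzDr// -invr_expz.
  have vl1 : cmod ((val v : R[i]) ^ l j0 : Cplx R) = 1.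
    by rewrite -(character_single l) cmod_character.
  have -> : ((val v : R[i]) ^ l j0)^-1 = ((val v : R[i]) ^ l j0)^*%C.
    apply: (@mulfI _ (val v ^ l j0)); first by rewrite expfz_neq0.
    by rewrite mulfV ?expfz_neq0// mul_conj_unit.
  by rewrite rmorphM /= mulrACA.
set c := (val v : R[i]) ^ _ in v1 Gw.
have mcG : cmeasurable (fun z => (c : Cplx R) * G z).
  by apply: cmeasurableM => //; exact: cmeasurable_cst.
have icG : cintegrable m (fun z => (c : Cplx R) * G z).
  apply: (@cintegrable_le _ _ (@character R k)) => //.
    exact: in_Lp_integrable (character_in_Lp k).1.
  move=> z; rewrite -[_ * _]/((fun z => (c : Cplx R) * G z) z) -Gw.
  by rewrite cmod_character G1.
have := @cintegral_rotation _ _ haar w G mG; rewrite Gw => /(_ icG).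
rewrite cintegralZ// => /eqP; rewrite -subr_eq0 -[X in _ - X]mul1r -mulrBl.
by rewrite mulf_eq0 subr_eq0 (negbTE v1) => /eqP.
Qed.

(** The character with exponent [kappa n.+1] is a lift of (n+1)^{-s} and has norm 1; [kappa_inj]
    makes its other coefficients vanish. *)
Lemma hardy_point_mass n :
  hardy m p (point_mass n 1) /\ hardy_norm m p (point_mass n 1) <= 1.
Proof.
have [XLp X1] := character_in_Lp (kappa n.+1).
have lift : bohr_lift m p (point_mass n 1) (@character R (kappa n.+1)).
  split; first split => //.
    move=> k [j kj]; rewrite fourier_character; case: eqP => // kE.
    by move: kj; rewrite -kE ltNge kappa_ge0.
  move=> k; rewrite fourier_character /point_mass.
  have [->|kn] := eqVneq k n; first by rewrite eqxx.
  by case: eqP => // /kappa_inj E; move: kn; rewrite -eqSS E// eqxx.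
split; first by exists (@character R (kappa n.+1)).
have infle : (ereal_inf [set Lp_norm m p F | F in bohr_lift m p (point_mass n 1%R)]
    <= 1)%E.
  by apply: ereal_inf_lbound; exists (@character R (kappa n.+1)).
have inf_ge0 : (0 <= ereal_inf
    [set Lp_norm m p F | F in bohr_lift m p (point_mass n 1%R)])%E.
  by apply: le_ereal_inf_tmp => _ [F _ <-]; exact: Lnorm_ge0.
rewrite -lee_fin /hardy_norm fineK// ge0_fin_numE//.
exact: le_lt_trans infle (ltry _).
Qed.

End Monomials.

(** * Semigroups *)

Lemma uniformly_continuous_near0 (R : realType) (V : lmodType R[i])
    (X : set V) (nrm : V -> R) (T : R -> V -> V) (e : R) : 0 < e ->
  uniformly_continuous_semigroup X nrm T ->
  exists2 d : R, 0 < d & forall t, 0 < t < d ->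
    forall f, X f -> nrm f <= 1 -> nrm (T t f - f) <= e.
Proof.
move=> e0 [_ cont].
have : \forall t \near 0^'+, (op_norm X nrm (fun f => T t f - f)%R < e%:E)%E.
  apply: (cont [set x | (x < e%:E)%E]); apply: open_nbhs_nbhs; split.
    exact: open_ereal_lt_ereal.
  by rewrite /= lte_fin.
move=> [d /= d0 dP]; exists d => // t /andP[t0 td] f Xf f1.
rewrite -lee_fin; apply: le_trans (ltW (dP t _ t0)).
  by apply: ereal_sup_ubound; exists f.
by rewrite /= sub0r normrN gtr0_norm.
Qed.

Lemma semigroup_eq_id (R : realType) (V : lmodType R[i]) (X : set V)
    (nrm : V -> R) (T : R -> V -> V) (d : R) : 0 < d ->
  semigroup X nrm T ->
  (forall t, 0 < t < d -> forall f, X f -> T t f = f) ->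
  forall t, 0 <= t -> forall f, X f -> T t f = f.
Proof.
move=> d0 [_ T0 TD] Tid t; rewrite le_eqVlt => /predU1P[<-|t0] f Xf.
  exact: T0.
(* As k > t/d, the step u = t/(k+1) is shorter than d, and [T t] is the (k+1)-fold iterate of
   [T u]. *)
pose k := Num.bound (t / d); pose u := t / k.+1%:R.
have u0 : 0 < u by rewrite divr_gt0.
have ud : u < d.
  rewrite ltr_pdivrMr// mulrC -ltr_pdivrMr//.
  apply: lt_trans (archi_boundP _) _; first by rewrite divr_ge0// ltW.
  by rewrite ltr_nat.
have iter j : T (u *+ j) f = f.
  elim: j => [|j IH]; first by rewrite mulr0n T0.
  by rewrite mulrS (TD _ _ (ltW u0) (mulrn_wge0 j (ltW u0)))// IH Tid// u0 ud.
by rewrite -[RHS](iter k.+1) /u -[_ / _ *+ _]mulr_natr divfK// pnatr_eq0.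
Qed.

(** The bound e/2 in norm becomes e on coefficients, through the factor 2 of
    [coef_le_hardy_norm]. *)
Lemma composition_near_id (R : realType) (m : probability (torus R) R)
    (p e : R) (T : dseries R -> dseries R) :
  is_haar m -> 1 <= p -> composition_operator m p T ->
  e <= 8^-1 ->
  100 * e < 2^-1 * cmod (1 - dirichlet_monomial 3 (period2 R) : Cplx R) ->
  (forall f, hardy m p f -> hardy_norm m p f <= 1 ->
    hardy_norm m p (T f - f) <= e / 2) ->
  forall f, hardy m p f -> T f = f.
Proof.
move=> haar p1 [[TX _ _] [Phi [PhiU _ TPhi]]] e8 ew Tnear.
have half s : 2 <= complex.Re s -> half_plane 2^-1 (s : Cplx R).
  by rewrite /half_plane /=; apply: lt_le_trans; lra.
pose A n := T (point_mass n 1).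
have Anear n i : cmod (A n i - (i == n)%:R) <= e.
  have [Xn n1] := @hardy_point_mass R m p haar p1 n.
  have := coef_le_hardy_norm i p1 (hardyB p1 (TX _ Xn) Xn).
  have := Tnear _ Xn n1.
  rewrite (_ : (T (point_mass n 1) - point_mass n 1) i = A n i - (i == n)%:R).
    by lra.
  by rewrite [LHS]/GRing.add /= [X in _ + X]/GRing.opp /= /point_mass;
    case: (i == n).
have Asum n s : 2 <= complex.Re s ->
    dirichlet_sum (A n) s = dirichlet_monomial n.+1 (Phi s).
  move=> s2; rewrite TPhi ?dirichlet_sum_point_mass ?mul1r//; last exact: half.
  exact: (@hardy_point_mass R m p haar p1 n).1.
have Phi0 s : 2 <= complex.Re s -> 0 <= complex.Re (Phi s).
  by move=> /half/PhiU; rewrite /half_plane /=; lra.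
have Aid := symbol_rigid e8 Anear Asum Phi0 ew.
have PhiE n s : 2 <= complex.Re s ->
    dirichlet_monomial n.+1 (Phi s) = dirichlet_monomial n.+1 s.
  by move=> s2; rewrite -Asum// Aid dirichlet_sum_point_mass mul1r.
(* Passage from monomials to all of the Hardy space goes through the symbol rather than density: the
   series of [f] at Phi(N) and at N agree term by term. *)
move=> f Xf; apply: dirichlet_sum_inj (hardy_bounded p1 (TX _ Xf))
  (hardy_bounded p1 Xf) _ => N N2.
have s2 := @two_le_Re_nat R N N2; rewrite TPhi//; last exact: half.
by congr (limn (series _)); apply/funext => n; rewrite PhiE.
Qed.

Theorem theorem5p8 (R : realType) (m : probability (torus R) R)
    (p : R) (T : R -> dseries R -> dseries R) :
  is_haar m -> 1 <= p ->
  (forall t : R, 0 <= t -> composition_operator m p (T t)) ->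
  uniformly_continuous_semigroup (hardy m p) (hardy_norm m p) T ->
  forall t : R, 0 <= t -> forall f, hardy m p f -> T t f = f.
Proof.
move=> haar p1 comp unif.
have w0 : 0 < cmod (1 - dirichlet_monomial 3 (period2 R) : Cplx R).
  by rewrite lt0r cmod_ge0 cmod_eq0 subr_eq0 eq_sym monomial3_period.
set w := cmod _ in w0.
(* With e <= w/400 one has 100 e <= w/4, strictly below the required w/2. *)
pose e := Num.min 8^-1 (w / 400).
have e0 : 0 < e by rewrite lt_min; apply/andP; split; lra.
have e8 : e <= 8^-1 by rewrite ge_min lexx.
have ew : 100 * e < 2^-1 * w.
  have : e <= w / 400 by rewrite ge_min lexx orbT.
  by lra.
have e20 : 0 < e / 2 by lra.
have [d d0 Td] := uniformly_continuous_near0 e20 unif.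
apply: (semigroup_eq_id d0 unif.1) => t /andP[t0 td].
apply: (composition_near_id haar p1 (comp t (ltW t0)) e8 ew).
by apply: Td; rewrite t0 td.
Qed.
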